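(* Every commutative (real or complex, not necessarily unital) C$^*$-algebra, regarded as a Jordan Banach triple with respect to the triple product $\{a,b,c\}=\frac12(ab^*c+cb^*a)$, is ternary weakly amenable.
   Context: A complex (resp., real) Jordan triple is a complex (resp., real) vector space $E$ with a non-trivial triple product $\{\cdot,\cdot,\cdot\}:E\times E\times E\to E$ that is bilinear and symmetric in the outer variables, conjugate linear (resp., linear) in the middle one, and satisfies $L(a,b)L(x,y)-L(x,y)L(a,b)=L(L(a,b)x,y)-L(x,L(b,a)y)$, where $L(x,y)z=\{x,y,z\}$. It is a Jordan Banach triple if $E$ is a Banach space and the triple product is continuous. A real C$^*$-algebra is a norm-closed real $*$-subalgebra of a complex C$^*$-algebra. The dual $E^*$ of a Jordan Banach triple $E$ is a Jordan triple $E$-module with the products $\{a,b,\varphi\}(x)=\{\varphi,b,a\}(x):=\varphi(\{b,a,x\})$ and $\{a,\varphi,b\}(x):=\overline{\varphi(\{a,x,b\})}$ for $a,b,x\in E$, $\varphi\in E^*$ (in the real case the conjugation is trivial). A ternary derivation $\delta:E\to E^*$ is a conjugate linear (linear, in the real case) map with $\delta\{a,b,c\}=\{\delta(a),b,c\}+\{a,\delta(b),c\}+\{a,b,\delta(c)\}$ for all $a,b,c\in E$. For $b\in E$, $\varphi\in E^*$, the map $\delta(b,\varphi):E\to E^*$, $\delta(b,\varphi)(a):=\{b,\varphi,a\}-\{\varphi,b,a\}$, is a ternary derivation; finite sums of such maps are called inner ternary derivations. $E$ is ternary weakly amenable if every continuous ternary derivation $E\to E^*$ is inner. *)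

(* Defs.v *)
From HB Require Import structures.
From mathcomp Require Import all_boot all_order all_algebra.
From mathcomp Require Import complex.
From mathcomp Require Import boolp classical_sets functions reals topology normedtype.

Set Implicit Arguments.
Unset Strict Implicit.
Unset Printing Implicit Defensive.

Import Order.TTheory GRing.Theory Num.Theory.
Import numFieldNormedType.Exports.

Local Open Scope classical_set_scope.
Local Open Scope ring_scope.

(* The complex and the real theory are treated together: [conj : K -> K] is
   complex conjugation when K = R[i], and the identity when K = R. *)
Section TernaryWeakAmenability.
Variables (K : numFieldType) (conj : K -> K) (E : normedModType K).

Record dual := Dual {
  dual_fun :> E -> K;
  dual_linear : forall (c : K) (x y : E),
    dual_fun (c *: x + y) = c * dual_fun x + dual_fun y;
  dual_continuous : continuous dual_fun }.

Variable triple : E -> E -> E -> E.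

(* {phi, b, a} = {a, b, phi}; such elements of the dual are handled through
   their underlying functions on E. *)
Definition triple_outer (phi : dual) (b a : E) : E -> K :=
  fun x => phi (triple b a x).

(* {a, phi, b} *)
Definition triple_middle (a : E) (phi : dual) (b : E) : E -> K :=
  fun x => conj (phi (triple a x b)).

Definition conj_linear (delta : E -> dual) : Prop :=
  forall (c : K) (a b : E),
    delta (c *: a + b) = (fun x => conj c * delta a x + delta b x) :> (E -> K).

Definition ternary_derivation (delta : E -> dual) : Prop :=
  conj_linear delta /\
  forall a b c : E,
    delta (triple a b c) =
      (fun x => triple_outer (delta a) b c x + triple_middle a (delta b) c x
                + triple_outer (delta c) b a x) :> (E -> K).

(* delta(b, phi) *)
Definition inner_generator (b : E) (phi : dual) (a : E) : E -> K :=
  fun x => triple_middle b phi a x - triple_outer phi b a x.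

Definition inner_ternary_derivation (delta : E -> dual) : Prop :=
  exists (n : nat) (b : 'I_n -> E) (phi : 'I_n -> dual),
    forall a : E,
      delta a = (fun x => \sum_(i < n) inner_generator (b i) (phi i) a x)
        :> (E -> K).

(* The topology of the dual norm is that of uniform convergence on the closed
   unit ball of E. *)
Definition norm_continuous_to_dual (delta : E -> dual) : Prop :=
  continuous
    ((fun a => dual_fun (delta a)) : E -> {uniform` [set x : E | `|x| <= 1] -> K}).

Definition ternary_weakly_amenable : Prop :=
  forall delta : E -> dual,
    ternary_derivation delta -> norm_continuous_to_dual delta ->
    inner_ternary_derivation delta.

End TernaryWeakAmenability.

(* Not necessarily unital, hence [mul] is not the product of a MathComp
   ring. *)
Record complex_cstar_algebra (R : realType) (A : completeNormedModType R[i])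
    (mul : A -> A -> A) (star : A -> A) : Prop := ComplexCstarAlgebra {
  cstar_mulA : associative mul;
  cstar_mulDl : left_distributive mul +%R;
  cstar_mulDr : right_distributive mul +%R;
  cstar_scaleAl : forall (c : R[i]) (x y : A), mul (c *: x) y = c *: mul x y;
  cstar_scaleAr : forall (c : R[i]) (x y : A), mul x (c *: y) = c *: mul x y;
  cstar_normM : forall x y : A, `|mul x y| <= `|x| * `|y|;
  cstar_starK : involutive star;
  cstar_starD : {morph star : x y / x + y};
  cstar_starZ : forall (c : R[i]) (x : A), star (c *: x) = c^* *: star x;
  cstar_starM : forall x y : A, star (mul x y) = mul (star y) (star x);
  cstar_norm : forall x : A, `|mul (star x) x| = `|x| ^+ 2 }.

(* [iota] identifies E, with its norm and operations, with a norm-closed real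
   *-subalgebra [range iota] of the complex C*-algebra A. *)
Record real_star_embedding (R : realType) (E : completeNormedModType R)
    (mul : E -> E -> E) (star : E -> E) (A : completeNormedModType R[i])
    (mulA : A -> A -> A) (starA : A -> A) (iota : E -> A) : Prop :=
    RealStarEmbedding {
  iotaD : {morph iota : x y / x + y};
  iotaZ : forall (r : R) (x : E), iota (r *: x) = (r%:C)%C *: iota x;
  iotaM : forall x y : E, iota (mul x y) = mulA (iota x) (iota y);
  iota_star : forall x : E, iota (star x) = starA (iota x);
  iota_norm : forall x : E, `|iota x| = (`|x|%:C)%C;
  iota_closed : closed (range iota) }.

Definition real_cstar_algebra (R : realType) (E : completeNormedModType R)
    (mul : E -> E -> E) (star : E -> E) : Prop :=
  exists (A : completeNormedModType R[i]) (mulA : A -> A -> A) (starA : A -> A)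
    (iota : E -> A),
    complex_cstar_algebra mulA starA /\
    real_star_embedding mul star mulA starA iota.

Definition cstar_triple (K : numFieldType) (E : lmodType K)
    (mul : E -> E -> E) (star : E -> E) (a b c : E) : E :=
  2^-1 *: (mul (mul a (star b)) c + mul (mul c (star b)) a).

(* Main.v *)
Require Import Defs.
From HB Require Import structures.
From mathcomp Require Import all_boot all_order all_algebra.
From mathcomp Require Import complex ring lra ssrAC.
From mathcomp Require Import boolp classical_sets functions reals topology normedtype.
Import Order.TTheory GRing.Theory Num.Theory.
Import numFieldNormedType.Exports.
Local Open Scope ring_scope.

Set Implicit Arguments.
Unset Strict Implicit.
Unset Printing Implicit Defensive.

(** Write a ternary derivation delta as the bilinear form
    B(a, x) = delta(star a)(x), and let B'(a, x) be the conjugate of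
    B(star a, star x).  Commutativity turns the derivation rule into
      B(abc, x) = B(a, bcx) + B'(b, acx) + B(c, abx),
    whose left-hand side is symmetric in a, b, c.

    The form B + B' satisfies the same identity without primes.  Products
    being dense, it is then an ordinary derivation into the dual
    ([triple_derivation_derivation]), and such a derivation T is 0
    ([derivation_zero]): if u is unitary, then T(u^n) = n u^(n-1) T(u) is bounded
    in n, so T(u) = 0, and a self-adjoint element is a rational function of its
    Cayley transform.

    The form S = B - B' is balanced: S(a, bx) = S(b, ax) ([triple_balanced]), so
    that formally S(a, x) = psi(ax).  If the algebra is unital, psi = S(1, .), and
    delta is the inner derivation given by 1 and a multiple of psi.
    In general the missing unit is replaced by a factorization psi = phi(b .) in
    the manner of Cohen ([balanced_factorization]).  It requires that psi be
    small, in norm, on the multiples of 1 - e for some element e of an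
    approximate unit ([form_tail_small]); this follows from the C*-identity,
    because almost orthogonal elements add up like vectors of a Hilbert space.
    Then delta is an inner derivation generated by b and a multiple of phi
    ([ternary_derivation_representation]).

    Resolvents 1 / (1 + h^2) of self-adjoint h provide both the unitaries and the
    approximate units.  To treat the two fields at once, the argument is
    carried out for a commutative Banach *-algebra that satisfies the C*-identity
    and |p|^2 <= |p^2 + q^2| for self-adjoint p and q ([comm_cstar]).  The
    inequality holds in complex C*-algebras ([complex_sumsq]) and passes to real
    *-subalgebras.  As real scalars lack the imaginary unit, a unitary is handled
    as the pair of its real and imaginary parts, which are self-adjoint. *)

(** * The unitization *)

Section Unitization.
Variables (K : fieldType) (E : lmodType K).

Record commutative_algebra (mul : E -> E -> E) : Prop := CommutativeAlgebra {
  comm_mulA : associative mul;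
  comm_mulC : commutative mul;
  comm_mulDl : left_distributive mul +%R;
  comm_scaleAl : forall (c : K) (x y : E), mul (c *: x) y = c *: mul x y }.

Variables (mul : E -> E -> E) (H : commutative_algebra mul).

Lemma comm_mulDr : right_distributive mul +%R.
Proof. by move=> x y z; rewrite !(comm_mulC H x) (comm_mulDl H). Qed.
Lemma comm_scaleAr (c : K) (x y : E) : mul x (c *: y) = c *: mul x y.
Proof. by rewrite !(comm_mulC H x) (comm_scaleAl H). Qed.
Lemma comm_mul0 x : mul 0 x = 0.
Proof. by rewrite -[X in mul X](scale0r (0 : E)) (comm_scaleAl H) scale0r. Qed.

(** The unitization K + E of a commutative algebra, as a commutative ring: it
    turns every identity between products in E into a goal for [ring], and it
    is where resolvents such as 1 - g live.  It carries no norm. *)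
Definition unitization of commutative_algebra mul : Type := (K * E)%type.

Local Notation U := (unitization H).

HB.instance Definition _ := GRing.Zmodule.copy U (K * E)%type.

Definition unit_one : U := (1, 0).
Definition unit_mul (u v : U) : U :=
  (u.1 * v.1, u.1 *: v.2 + v.1 *: u.2 + mul u.2 v.2).

Lemma unit_mulA : associative unit_mul.
Proof.
case=> a x [b y] [c z]; rewrite /unit_mul /=; congr pair; first exact: mulrA.
rewrite !comm_mulDr !(comm_mulDl H) !comm_scaleAr !(comm_scaleAl H) (comm_mulA H).
rewrite !scalerDr !scalerA (mulrC c a) (mulrC c b) !addrA.
by congr (_ + _); rewrite [LHS](ACl (1*2*4*6*3*5)).
Qed.

Lemma unit_mulC : commutative unit_mul.
Proof.
case=> a x [b y]; rewrite /unit_mul /= mulrC (comm_mulC H); congr pair.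
by congr (_ + _); rewrite addrC.
Qed.

Lemma unit_mul1 : left_id unit_one unit_mul.
Proof.
by case=> a x; rewrite /unit_mul /= mul1r scale1r scaler0 addr0 comm_mul0 addr0.
Qed.

Lemma unit_mulDl : left_distributive unit_mul +%R.
Proof.
case=> a x [b y] [c z]; congr pair; first by rewrite mulrDl.
by rewrite /= (comm_mulDl H) scalerDl scalerDr !addrA [RHS](ACl (1*4*2*5*3*6)).
Qed.

Lemma unit_one_neq0 : unit_one != 0.
Proof. by rewrite xpair_eqE negb_and oner_eq0. Qed.

HB.instance Definition _ := GRing.Zmodule_isComNzRing.Build U
  unit_mulA unit_mulC unit_mul1 unit_mulDl unit_one_neq0.

End Unitization.

(** * Geometric convergence *)

Section RealEstimates.
Variable R : realType.

Lemma ler0_eps (a C : R) : (forall e, 0 < e -> a <= C * e) -> a <= 0.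
Proof.
move=> H; rewrite leNgt; apply/negP => a0.
have C1 : 0 < 2 * (`|C| + 1) by have := normr_ge0 C; lra.
have e0 : 0 < a / (2 * (`|C| + 1)) by rewrite divr_gt0.
have := H _ e0; rewrite mulrA ler_pdivlMr //.
have : C * a <= `|C| * a by rewrite ler_wpM2r ?ler_norm // ltW.
have := normr_ge0 C; nra.
Qed.

Lemma ler0_archi (a C : R) : (forall n : nat, n%:R * a <= C) -> a <= 0.
Proof.
move=> H; apply: (@ler0_eps _ `|C|) => e e0.
have ie : 0 <= e^-1 by rewrite invr_ge0 ltW.
have := archi_boundP ie; set n := Num.Def.archi_bound _ => /ltW ien.
have n0 : 0 < n%:R :> R by apply: lt_le_trans ien; rewrite invr_gt0.
have : a <= `|C| / n%:R.
  by rewrite ler_pdivlMr // mulrC (le_trans (H n)) ?ler_norm.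
move=> /le_trans; apply; rewrite ler_wpM2l //.
by rewrite -[e]invrK lef_pV2 ?posrE ?invr_gt0.
Qed.

(** A common ratio for all the iterations below.  It is the shrinking factor
    1 - 1/8 of the scalar parts in the factorization of balanced forms, and it
    exceeds the ratio 1/2 of the Neumann series. *)
Definition rho : R := 7 / 8.

Lemma rho_bound n : n%:R * rho ^+ n <= 7.
Proof.
have e1 : (8 / 7) ^+ n * rho ^+ n = 1 :> R.
  by rewrite -exprMn (_ : 8 / 7 * rho = 1) ?expr1n // /rho; lra.
suff: n%:R <= 7 * (8 / 7) ^+ n :> R.
  have rho0 : 0 <= rho ^+ n by rewrite exprn_ge0 // /rho; lra.
  by move=> /(ler_wpM2r rho0); rewrite -mulrA e1 mulr1.
clear e1; elim: n => [|n IH]; first by rewrite expr0 mulr1; lra.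
have : 1 <= (8 / 7) ^+ n :> R by rewrite exprn_ege1 //; lra.
by rewrite exprS -[n.+1%:R]natr1; lra.
Qed.

Lemma rho_gt0 n : 0 < rho ^+ n.
Proof. by rewrite exprn_gt0 // /rho; lra. Qed.

(** The bound [n * rho ^ n <= 7] turns the hypothesis into an Archimedean one. *)
Lemma ler0_geom (a C : R) : (forall n, a <= C * rho ^+ n) -> a <= 0.
Proof.
move=> H; apply: (@ler0_archi _ (7 * `|C|)) => n.
apply: le_trans (_ : n%:R * (`|C| * rho ^+ n) <= _).
  rewrite ler_wpM2l // (le_trans (H n)) // ler_wpM2r ?ler_norm //.
  by rewrite ltW ?rho_gt0.
by rewrite mulrCA mulrC ler_wpM2r ?rho_bound.
Qed.

(** The part of completeness that the proof uses.  Stating it for a real valued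
    [nu] on a bare group lets it apply both to the algebra and to its field of
    scalars. *)
Definition geom_complete (V : zmodType) (nu : V -> R) : Prop :=
  forall (C : R) (u : nat -> V),
    (forall n, nu (u n.+1 - u n) <= C * rho ^+ n) ->
    exists l, forall e, 0 < e ->
      exists N, forall n, (N <= n)%N -> nu (u n - l) <= e.

Lemma geom_partial (V : zmodType) (nu : V -> R) (C : R) (u : nat -> V) :
  (forall x y, nu (x + y) <= nu x + nu y) -> nu 0 = 0 ->
  (forall n, nu (u n.+1 - u n) <= C * rho ^+ n) ->
  forall n k, nu (u (k + n)%N - u n) <= 8 * C * (rho ^+ n - rho ^+ (k + n)).
Proof.
move=> nuD nu0 H n; elim=> [|k IH]; first by rewrite add0n !subrr nu0 mulr0.
rewrite -(subrKA (u (k + n)%N)) (le_trans (nuD _ _)) //.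
have := H (k + n)%N; rewrite addSn exprS; move: IH.
by set X := rho ^+ (k + n); set Y := rho ^+ n; rewrite /rho; lra.
Qed.

Lemma geom_limit (V : zmodType) (nu : V -> R) (C : R) (u : nat -> V) :
  (forall x y, nu (x + y) <= nu x + nu y) -> (forall x, nu (- x) = nu x) ->
  nu 0 = 0 -> geom_complete nu ->
  (forall n, nu (u n.+1 - u n) <= C * rho ^+ n) ->
  exists l, forall n, nu (u n - l) <= 8 * C * rho ^+ n.
Proof.
move=> nuD nuN nu0 comp H; have [l Hl] := comp C u H; exists l => n.
have partial k := geom_partial nuD nu0 H n k.
have C0 : 0 <= 8 * C.
  have := H 0%N; rewrite expr0 mulr1.
  have := nuD (u 1%N - u 0%N) (- (u 1%N - u 0%N)); rewrite nuN subrr nu0; lra.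
rewrite -subr_le0; apply: (@ler0_eps _ 1) => e e0; rewrite mul1r.
have [N HN] := Hl e e0.
have := HN _ (leq_addr n N); have := partial N.
have := nuD (- (u (N + n)%N - u n)) (u (N + n)%N - l).
rewrite nuN opprB subrKA.
have : 0 <= 8 * C * rho ^+ (N + n) by rewrite mulr_ge0 // ltW // rho_gt0.
rewrite mulrBr; lra.
Qed.

End RealEstimates.

(** * Commutative C*-algebras and resolvents *)

(** The scalars: a field [K] with an absolute value [ab], an embedding [kap] of
    the reals and a conjugation.  Norms take real values here, whereas those of
    a complex normed space lie in R[i], so that inequalities are between real
    numbers. *)
Record valued_scalars (R : realType) (K : fieldType) (kap : {rmorphism R -> K})
    (ab : K -> R) (conj : K -> K) : Prop := ValuedScalars {
  ab_ge0 : forall x, 0 <= ab x;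
  ab_eq0 : forall x, ab x = 0 -> x = 0;
  abD : forall x y, ab (x + y) <= ab x + ab y;
  abM : forall x y, ab (x * y) = ab x * ab y;
  ab_real : forall r, ab (kap r) = `|r|;
  ab_complete : geom_complete ab;
  sconjD : {morph conj : x y / x + y};
  sconjM : {morph conj : x y / x * y};
  sconjK : involutive conj;
  sconj_real : forall r, conj (kap r) = kap r;
  ab_conj : forall x, ab (conj x) = ab x }.

(** What a commutative real or complex C*-algebra is used for.  In the real case
    the C*-identity alone would not do (the complex numbers with the trivial
    involution satisfy it); the last clause is the extra condition, and it holds in
    every *-subalgebra of a complex C*-algebra. *)
Record comm_cstar (R : realType) (K : fieldType) (kap : {rmorphism R -> K})
    (ab : K -> R) (conj : K -> K) (E : lmodType K) (mul : E -> E -> E)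
    (star : E -> E) (nu : E -> R) : Prop := CommCstar {
  cs_alg :> commutative_algebra mul;
  nu_ge0 : forall x, 0 <= nu x;
  nu_eq0 : forall x, nu x = 0 -> x = 0;
  nuD : forall x y, nu (x + y) <= nu x + nu y;
  nuZ : forall c x, nu (c *: x) = ab c * nu x;
  nuM : forall x y, nu (mul x y) <= nu x * nu y;
  nu_complete : geom_complete nu;
  starK : involutive star;
  starD : {morph star : x y / x + y};
  starZ : forall c x, star (c *: x) = conj c *: star x;
  starM : forall x y, star (mul x y) = mul (star x) (star y);
  nu_cstar : forall x, nu (mul (star x) x) = nu x ^+ 2;
  nu_sumsq : forall p q, star p = p -> star q = q ->
    nu p ^+ 2 <= nu (mul p p + mul q q) }.

Section CommutativeCstar.
Variables (R : realType) (K : fieldType) (kap : {rmorphism R -> K}).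
Variables (ab : K -> R) (conj : K -> K) (HK : valued_scalars kap ab conj).
Variables (E : lmodType K) (mul : E -> E -> E) (star : E -> E) (nu : E -> R).
Hypothesis HE : comm_cstar kap ab conj mul star nu.

Local Notation U := (unitization (cs_alg HE)).
Local Infix "**" := mul (at level 40, left associativity).

Definition emb (x : E) : U := (0, x).
Definition scal (c : K) : U := (c, 0).
Definition act (u : U) (x : E) : E := u.1 *: x + u.2 ** x.

Lemma emb_inj : injective emb. Proof. by move=> x y []. Qed.
Lemma embD x y : emb (x + y) = emb x + emb y.
Proof. by rewrite /emb; congr pair; rewrite addr0. Qed.
Lemma emb0 : emb 0 = 0. Proof. by []. Qed.
Lemma embN x : emb (- x) = - emb x.
Proof. by rewrite /emb; congr pair; rewrite oppr0. Qed.
Lemma mulE0 x : 0 ** x = 0. Proof. exact: comm_mul0 HE x. Qed.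
Lemma mulEC : commutative mul. Proof. exact: comm_mulC HE. Qed.
Lemma embM x y : emb (x ** y) = emb x * emb y.
Proof. by congr pair; rewrite /= ?mulr0 // !scale0r !add0r. Qed.
Lemma embZ c x : emb (c *: x) = scal c * emb x.
Proof. by congr pair; rewrite /= ?mulr0 // scaler0 mulE0 !addr0. Qed.
Lemma emb_act u x : emb (act u x) = u * emb x.
Proof. by congr pair; rewrite /= ?mulr0 // scale0r addr0. Qed.
Lemma scal1 : scal 1 = 1. Proof. by []. Qed.
Lemma scalM c d : scal (c * d) = scal c * scal d.
Proof. by congr pair; rewrite /= mulE0 !scaler0 !addr0. Qed.
Lemma scalD c d : scal (c + d) = scal c + scal d.
Proof. by congr pair; rewrite /= addr0. Qed.
Definition embE := (embD, embN, embM, embZ, emb_act, emb0).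

Lemma act_sub1 e x : act (1 - emb e) x = x - e ** x.
Proof. by apply: emb_inj; rewrite !embE; ring. Qed.

Lemma star0 : star 0 = 0.
Proof. by apply: (addrI (star 0)); rewrite -(starD HE) !addr0. Qed.

Lemma starN x : star (- x) = - star x.
Proof.
by apply: (addrI (star x)); rewrite -(starD HE) !subrr star0.
Qed.

Lemma starB x y : star (x - y) = star x - star y.
Proof. by rewrite (starD HE) starN. Qed.

Lemma starZr (r : R) x : star (kap r *: x) = kap r *: star x.
Proof. by rewrite (starZ HE) (sconj_real HK). Qed.

Lemma nu0 : nu 0 = 0.
Proof.
by have := nuZ HE (kap 0) 0; rewrite (ab_real HK) normr0 mul0r scaler0.
Qed.

Lemma nuZr r x : 0 <= r -> nu (kap r *: x) = r * nu x.
Proof. by move=> r0; rewrite (nuZ HE) (ab_real HK) ger0_norm. Qed.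

Lemma nuN x : nu (- x) = nu x.
Proof.
by rewrite -scaleN1r (nuZ HE) -(rmorph1 kap) -rmorphN (ab_real HK) normrN1 mul1r.
Qed.

Lemma nuB x y : nu (x - y) <= nu x + nu y.
Proof. by rewrite -(nuN y) (nuD HE). Qed.

Lemma nu_star x : nu (star x) = nu x.
Proof.
have le y : nu y <= nu (star y).
  have := nuM HE (star y) y; rewrite (nu_cstar HE) expr2.
  have := nu_ge0 HE y; have := nu_ge0 HE (star y); nra.
by apply/eqP; rewrite eq_le le -{2}(starK HE x) le.
Qed.

(** The Neumann series, summed by iterating [w := k - k w]. *)
Lemma quasi_inverse k : nu k <= 1 / 2 ->
  exists w, nu w <= 1 /\ (1 + emb k) * (1 - emb w) = 1.
Proof.
move=> k2; pose u := fix u n := if n is n'.+1 then k - k ** u n' else 0.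
have uS n : u n.+1 = k - k ** u n by [].
have du n : nu (u n.+1 - u n) <= 1 * rho R ^+ n.
  elim: n => [|n IH].
    by rewrite uS /= (mulEC k) mulE0 !subr0 expr0; lra.
  have -> : u n.+2 - u n.+1 = - (k ** (u n.+1 - u n)).
    by rewrite !(uS _.+1) {2}uS; apply: emb_inj; rewrite !embE; ring.
  rewrite nuN (le_trans (nuM HE _ _)) // exprS; move: IH.
  have := nu_ge0 HE (u n.+1 - u n); have := rho_gt0 R n.
  by set X := rho R ^+ n; rewrite /rho; have := nu_ge0 HE k; nra.
have [w Hw] := geom_limit (nuD HE) nuN nu0 (nu_complete HE) du; exists w.
have wk : w + k ** w - k = 0.
  apply: (nu_eq0 HE); apply/eqP; rewrite eq_le (nu_ge0 HE) andbT.
  apply: (@ler0_geom _ _ 16) => n.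
  have -> : w + k ** w - k = - (u n.+1 - w) - k ** (u n - w).
    by rewrite uS; apply: emb_inj; rewrite !embE; ring.
  have := nuB (- (u n.+1 - w)) (k ** (u n - w)); rewrite nuN.
  have := nuM HE k (u n - w); have := Hw n; have := Hw n.+1; rewrite exprS.
  have := nu_ge0 HE (u n - w); have := rho_gt0 R n.
  by set X := rho R ^+ n; rewrite /rho; nra.
have wE : w = k - k ** w by apply/eqP; rewrite -subr_eq0 opprB addrA wk.
split.
  have := nuB k (k ** w); rewrite -wE; have := nuM HE k w; have := nu_ge0 HE w; nra.
have := congr1 emb wk; rewrite !embE => wk'.
rewrite (_ : _ * _ = 1 - (emb w + emb k * emb w - emb k)); last by ring.
by rewrite wk' subr0.
Qed.

(** [1 - g = 1 / (1 + h ^ 2)]; for self-adjoint [h] the element [1 - 2 g] is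
    the real part of the Cayley transform of [h] and [2 (h - h g)] is, up to
    sign, its imaginary part. *)
Definition resolvent (h g : E) : Prop := (1 + emb h * emb h) * (1 - emb g) = 1.

Lemma resolventE h g : resolvent h g -> g + h ** h ** g = h ** h.
Proof.
move=> H; apply: emb_inj; rewrite !embE; apply/eqP; rewrite -subr_eq0.
rewrite (_ : _ - _ = 1 - (1 + emb h * emb h) * (1 - emb g)); last by ring.
by rewrite H subrr.
Qed.

Lemma inverse_uniq (a x y : U) : a * x = 1 -> a * y = 1 -> x = y.
Proof. by move=> ax ay; rewrite -[x]mulr1 -ay mulrCA mulrA ax mul1r. Qed.

Lemma resolvent_star h g : star h = h -> resolvent h g -> star g = g.
Proof.
move=> hs H; have E1 := resolventE H; have := congr1 star E1.
rewrite (starD HE) !(starM HE) !hs => E2.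
have H2 : resolvent h (star g).
  have := congr1 emb E2; rewrite !embE => E3.
  rewrite /resolvent.
  rewrite (_ : _ * _ = 1 + emb h * emb h
    - (emb (star g) + emb h * emb h * emb (star g))); last by ring.
  by rewrite E3 addrK.
have := inverse_uniq H2 H => /(congr1 (fun x => 1 - x)).
by rewrite !subKr => /emb_inj.
Qed.

(** With [f = h - h g] one has [g ^ 2 + f ^ 2 = g], so both norms are controlled
    by [nu_sumsq]. *)
Lemma resolvent_bound h g : star h = h -> resolvent h g ->
  nu g <= 1 /\ nu (h - h ** g) <= 1.
Proof.
move=> hs H; have gs := resolvent_star hs H.
have E1 := congr1 emb (resolventE H); rewrite !embE in E1.
pose f := h - h ** g.
have fs : star f = f by rewrite /f starB (starM HE) hs gs.
have sq : g ** g + f ** f = g.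
  apply: emb_inj; rewrite /f !embE.
  rewrite (_ : _ + _ = emb g * emb g
    + (emb h * emb h - emb h * emb h * emb g) * (1 - emb g)); last by ring.
  by rewrite -{1}E1 addrK; ring.
have := nu_sumsq HE fs gs; rewrite (addrC (f ** f)) sq expr2 => f2.
have := nu_sumsq HE gs fs; rewrite sq expr2 => g2.
have g1 : nu g <= 1 by have := nu_ge0 HE g; nra.
by split=> //; have := nu_ge0 HE f; rewrite -/f; nra.
Qed.

Definition contraction (u : U) : Prop := forall x, nu (act u x) <= nu x.

Lemma actM u v x : act (u * v) x = act u (act v x).
Proof. by apply: emb_inj; rewrite !embE mulrA. Qed.

Lemma contractionM u v : contraction u -> contraction v -> contraction (u * v).
Proof. by move=> Hu Hv x; rewrite actM (le_trans (Hu _)). Qed.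

(** [1 - 2 g] is the real part of a unitary, hence contracts self-adjoint
    elements; applying it twice to [star x ** x] gives all elements, and
    [1 - g] is the average of [1] and [1 - 2 g]. *)
Lemma resolvent_contraction h g : star h = h -> resolvent h g ->
  contraction (1 - emb g).
Proof.
move=> hs H x; have gs := resolvent_star hs H.
have E1 := congr1 emb (resolventE H); rewrite !embE in E1.
pose c0 : U := 1 - emb g - emb g; pose s0 := h - h ** g + (h - h ** g).
have c0s y : star y = y -> star (act c0 y) = act c0 y.
  move=> ys; have -> : act c0 y = y - g ** y - g ** y.
    by apply: emb_inj; rewrite /c0 !embE; ring.
  by rewrite !starB !(starM HE) gs ys.
(* [act c0 y] and [s0 ** y] are the real and imaginary parts of a unitary
   times [y]. *)
have c0sa y : star y = y -> nu (act c0 y) <= nu y.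
  move=> ys; have s0s : star (s0 ** y) = s0 ** y.
    by rewrite (starM HE) ys (starD HE) !starB !(starM HE) hs gs.
  have := nu_sumsq HE (c0s y ys) s0s.
  have -> : act c0 y ** act c0 y + s0 ** y ** (s0 ** y) = star y ** y.
    rewrite ys; apply: emb_inj; rewrite /c0 /s0 !embE.
    rewrite (_ : _ + _ = emb y * emb y * (1 - 4 * (emb g - emb g * emb g)
       + 4 * (emb h * emb h - emb h * emb h * emb g) * (1 - emb g))); last by ring.
    by rewrite -{1}E1 addrK; ring.
  by rewrite (nu_cstar HE) ler_pXn2r // nnegrE (nu_ge0 HE).
have c0c : nu (act c0 x) <= nu x.
  have xxs : star (star x ** x) = star x ** x.
    by rewrite (starM HE) (starK HE) mulEC.
  have := le_trans (c0sa _ (c0s _ xxs)) (c0sa _ xxs).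
  have -> : act c0 (act c0 (star x ** x)) = star (act c0 x) ** act c0 x.
    have -> : star (act c0 x) = act c0 (star x).
      have e y : act c0 y = y - g ** y - g ** y.
        by apply: emb_inj; rewrite /c0 !embE; ring.
      by rewrite !e !starB !(starM HE) gs.
    by apply: emb_inj; rewrite !embE; ring.
  by rewrite !(nu_cstar HE) ler_pXn2r // nnegrE (nu_ge0 HE).
have e2 : kap 2 *: act (1 - emb g) x = x + act c0 x.
  rewrite rmorphD rmorph1 scalerDl scale1r.
  by apply: emb_inj; rewrite /c0 !embE; ring.
have := nuD HE x (act c0 x); rewrite -e2 nuZr //; lra.
Qed.

(** ** Existence of resolvents and approximate units *)

Lemma resolvent_small h : nu h <= 1 / 2 -> exists g, resolvent h g.
Proof.
move=> h2; have : nu (h ** h) <= 1 / 2.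
  by rewrite (le_trans (nuM HE _ _)) //; have := nu_ge0 HE h; nra.
by move=> /quasi_inverse [g [_ H]]; exists g; rewrite /resolvent -embM.
Qed.

(** Continuation: [(6/5)^2 = 1 + 11/25], hence
    [1 + (6/5 h)^2 = (1 + h^2) (1 + 11/25 g)], and the second factor is
    inverted by a Neumann series since [g] has norm at most 1.  The factor 6/5
    does not depend on [h], so iteration reaches every multiple of [h]. *)
Lemma resolvent_step h g : star h = h -> resolvent h g ->
  exists g', resolvent (kap (6 / 5) *: h) g'.
Proof.
move=> hs H; have [g1 _] := resolvent_bound hs H.
have : nu (kap (11 / 25) *: g) <= 1 / 2 by rewrite nuZr; lra.
move=> /quasi_inverse [w [_ Hw]]; exists (g + w - g ** w).
have E1 := congr1 emb (resolventE H); rewrite !embE in E1.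
have c2 : scal (kap (6 / 5)) * scal (kap (6 / 5)) = 1 + scal (kap (11 / 25)).
  rewrite -scalM -rmorphM -scal1 -(rmorph1 kap) -scalD -rmorphD.
  by congr (scal (kap _)); lra.
rewrite /resolvent -[RHS]Hw !embE.
rewrite (_ : _ * _ = (1 + scal (kap (6 / 5)) * scal (kap (6 / 5)) * (emb h * emb h))
   * (1 - emb g) * (1 - emb w)); last by ring.
congr (_ * _); rewrite c2.
rewrite (_ : _ * _ = (1 + emb h * emb h) * (1 - emb g)
   + scal (kap (11 / 25)) * (emb h * emb h - emb h * emb h * emb g)); last by ring.
by rewrite H -{1}E1 addrK.
Qed.

Lemma resolvent_exists h : star h = h -> exists g, resolvent h g.
Proof.
have gen n : forall h, star h = h -> nu h <= 1 / 2 * (6 / 5) ^+ n ->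
    exists g, resolvent h g.
  elim: n => [|n IH] {}h hs hn.
    by apply: resolvent_small; move: hn; rewrite expr0 mulr1.
  have hE : h = kap (6 / 5) *: (kap (5 / 6) *: h).
    by rewrite scalerA -rmorphM (_ : _ * _ = 1) ?rmorph1 ?scale1r //; lra.
  have hs' : star (kap (5 / 6) *: h) = kap (5 / 6) *: h by rewrite starZr hs.
  have [|g Hg] := IH _ hs'; last by rewrite hE; apply: resolvent_step hs' Hg.
  by move: hn; rewrite exprS nuZr; lra.
move=> hs; have h0 : 0 <= 10 * nu h by have := nu_ge0 HE h; lra.
have := archi_boundP h0; set n := Num.Def.archi_bound _ => hn.
apply: (gen n) => //.
have : n%:R / 5 <= (6 / 5) ^+ n :> R.
  elim: (n) => [|k IH]; first by rewrite mul0r expr0; lra.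
  have : 1 <= (6 / 5) ^+ k :> R by rewrite exprn_ege1 //; lra.
  by rewrite exprS -[k.+1%:R]natr1; lra.
by lra.
Qed.

(** Take [e = h^2 / (1 + h^2)] with [h] a large multiple of [star y ** y].  That
    [e] is a multiple of [y] serves to treat skew elements. *)
Lemma approximate_unit y eps : 0 < eps ->
  exists e m, [/\ e = y ** m, star e = e, contraction (1 - emb e)
    & nu (y - e ** y) <= eps].
Proof.
move=> eps0; pose h0 := star y ** y.
(* [s (h0 - h0 g)] has norm at most 1, and the norm of [h0 - h0 g] bounds the
   square of that of [y - g y]. *)
pose s := (eps ^+ 2)^-1.
have s0 : 0 < s by rewrite invr_gt0 exprn_gt0.
have [h hE] : exists h, h = kap s *: h0 by exists (kap s *: h0).
have hE' := congr1 emb hE; rewrite embZ embM in hE'.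
have hs : star h = h by rewrite hE starZr /h0 (starM HE) (starK HE) mulEC.
have [g Hg] := resolvent_exists hs.
have gs := resolvent_star hs Hg; have cg := resolvent_contraction hs Hg.
have [_ f1] := resolvent_bound hs Hg.
exists g, (kap s *: (star y ** (h - h ** g))); split=> //.
  have E1 := congr1 emb (resolventE Hg).
  apply: emb_inj; rewrite !embE in E1 *.
  rewrite (_ : _ * _ = emb h * (emb h - emb h * emb g)).
    by rewrite mulrBr mulrA -{1}E1; ring.
  by rewrite [X in _ = X * _]hE'; ring.
have : nu (y - g ** y) ^+ 2 <= nu (h0 - h0 ** g).
  rewrite -(nu_cstar HE) (le_trans _ (cg _)) //.
  rewrite le_eqVlt; apply/orP; left; apply/eqP; congr nu.
  by rewrite starB (starM HE) gs; apply: emb_inj; rewrite /h0 !embE; ring.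
have : nu (h0 - h0 ** g) <= eps ^+ 2.
  rewrite -[leRHS]invrK -/s -[leRHS]mulr1 ler_pdivlMl //.
  rewrite -(nuZr _ (ltW s0)) (le_trans _ f1) // le_eqVlt; apply/orP; left.
  by apply/eqP; congr nu; apply: emb_inj; rewrite hE !embE; ring.
move=> a1 a2; have := le_trans a2 a1.
by rewrite ler_pXn2r // nnegrE ?(nu_ge0 HE) // ltW.
Qed.

Lemma ab0 : ab 0 = 0.
Proof. by have := ab_real HK 0; rewrite rmorph0 normr0. Qed.

Lemma abN x : ab (- x) = ab x.
Proof.
by rewrite -mulN1r (abM HK) -(rmorph1 kap) -rmorphN (ab_real HK) normrN1 mul1r.
Qed.

Lemma ab_small0 x (C : R) : (forall e, 0 < e -> ab x <= C * e) -> x = 0.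
Proof.
move=> /ler0_eps x0; apply: (ab_eq0 HK).
by apply/eqP; rewrite eq_le x0 (ab_ge0 HK).
Qed.

Definition bounded_additive (F : E -> K) : Prop :=
  {morph F : x y / x + y} /\ exists M, forall x, ab (F x) <= M * nu x.

(** Products are dense. *)
Lemma vanish_on_products F : bounded_additive F ->
  (forall c y, F (c ** y) = 0) -> forall x, F x = 0.
Proof.
move=> [FD [M FM]] F0 x; apply: (@ab_small0 _ `|M|) => eps eps0.
have [e [m [_ _ _ He]]] := approximate_unit x eps0.
rewrite -[x](subrK (e ** x)) FD F0 addr0 (le_trans (FM _)) //.
rewrite (le_trans (ler_wpM2r (nu_ge0 HE _) (ler_norm M))) //.
by rewrite ler_wpM2l.
Qed.

(** ** Bounded derivations into the dual vanish *)

Lemma mulEA : associative mul. Proof. exact: comm_mulA HE. Qed.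
Lemma mulEDr : right_distributive mul +%R. Proof. exact: comm_mulDr HE. Qed.

(** Proves identities in the algebra from those of its unitization. *)
Ltac algebra := apply: emb_inj; rewrite !embE; ring.

Lemma bounded_additive_mul c F : bounded_additive F ->
  bounded_additive (fun x => F (c ** x)).
Proof.
move=> [FD [M FM]]; split=> [x y|]; first by rewrite mulEDr FD.
exists (`|M| * nu c) => x; rewrite (le_trans (FM _)) // -mulrA.
rewrite (le_trans (ler_wpM2r (nu_ge0 HE _) (ler_norm M))) //.
by rewrite ler_wpM2l // (nuM HE).
Qed.

Lemma bounded_additiveB F G : bounded_additive F -> bounded_additive G ->
  bounded_additive (fun x => F x - G x).
Proof.
move=> [FD [M FM]] [GD [N GN]]; split=> [x y|]; first by rewrite FD GD; ring.
exists (M + N) => x; rewrite (le_trans (abD HK _ _)) // abN.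
by have := FM x; have := GN x; lra.
Qed.

Record bounded_form (B : E -> E -> K) (M : R) : Prop := BoundedForm {
  formDl : forall x y z, B (x + y) z = B x z + B y z;
  formDr : forall x y z, B x (y + z) = B x y + B x z;
  formZl : forall c x y, B (c *: x) y = c * B x y;
  formZr : forall c x y, B x (c *: y) = c * B x y;
  form_bound_ge0 : 0 <= M;
  form_bound : forall x y, ab (B x y) <= M * (nu x * nu y) }.

Section Form.
Variables (B : E -> E -> K) (M : R) (HB : bounded_form B M).

Lemma formNl x y : B (- x) y = - B x y.
Proof. by rewrite -scaleN1r (formZl HB) mulN1r. Qed.
Lemma formNr x y : B x (- y) = - B x y.
Proof. by rewrite -scaleN1r (formZr HB) mulN1r. Qed.
Lemma form0l y : B 0 y = 0.
Proof. by rewrite -(scale0r 0) (formZl HB) mul0r. Qed.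
Lemma formBl x y z : B (x - y) z = B x z - B y z.
Proof. by rewrite (formDl HB) formNl. Qed.
Lemma formBr x y z : B x (y - z) = B x y - B x z.
Proof. by rewrite (formDr HB) formNr. Qed.

Lemma form_bounded_additive a : bounded_additive (B a).
Proof.
split=> [x y|]; first exact: (formDr HB).
by exists (M * nu a) => x; rewrite -mulrA (form_bound HB).
Qed.

End Form.

Lemma double_eq0 (z : K) : z + z = 0 -> z = 0.
Proof.
move=> z2; have : kap 2 * z = 0 by rewrite rmorphD rmorph1 mulrDl mul1r.
move=> /eqP; rewrite mulf_eq0 => /orP[|/eqP //].
by rewrite fmorph_eq0 pnatr_eq0.
Qed.

Lemma double_inj (z t : K) : z + z = t + t -> z = t.
Proof.
move=> e; apply/eqP; rewrite -subr_eq0; apply/eqP/double_eq0.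
by rewrite addrACA e; ring.
Qed.

Section Derivations.
Variables (T : E -> E -> K) (M : R) (HT : bounded_form T M).

(** The defect [D] of the Leibniz rule changes sign when a factor moves out of
    its first argument, and is unchanged when both arguments are exchanged with
    factors of the third; this gives [D = - D] once the third argument is a
    product of three factors. *)
Lemma triple_derivation_derivation :
  (forall a b c x, T (a ** b ** c) x =
     T a (b ** c ** x) + T b (a ** c ** x) + T c (a ** b ** x)) ->
  forall a b x, T (a ** b) x = T a (b ** x) + T b (a ** x).
Proof.
move=> H3; pose D a b x := T (a ** b) x - T a (b ** x) - T b (a ** x).
have DC a b x : D a b x = D b a x by rewrite /D (mulEC a b); ring.
have D3 a b c x : D (a ** b) c x = - D a b (c ** x).
  rewrite /D H3 !mulEA; ring.
have Dswap a b c d x : D a b (c ** d ** x) = D c d (a ** b ** x).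
  by apply: oppr_inj; rewrite -!D3 DC.
have D0 a b c d e x : D a b (c ** (d ** (e ** x))) = 0.
  apply: double_eq0; rewrite -[X in X + _]opprK -D3 (mulEA d) Dswap.
  rewrite (_ : a ** b ** c ** x = a ** b ** (c ** x)); last by rewrite !mulEA.
  rewrite Dswap (_ : d ** e ** (c ** x) = c ** (d ** e ** x)); last by algebra.
  by rewrite -mulEA addNr.
have ba a b : bounded_additive (D a b).
  have Tb u v : bounded_additive (fun x => T u (v ** x)).
    exact: (bounded_additive_mul v (form_bounded_additive HT u)).
  apply: (bounded_additiveB _ (Tb b a)); apply: (bounded_additiveB _ (Tb a b)).
  exact: form_bounded_additive HT _.
move=> a b x; suff : D a b x = 0.
  by rewrite /D -addrA -opprD => /eqP; rewrite subr_eq0 => /eqP.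
apply: (vanish_on_products (ba a b)) => c {}x.
apply: (vanish_on_products (bounded_additive_mul c (ba a b))) => d {}x.
have bacd := bounded_additive_mul d (bounded_additive_mul c (ba a b)).
by apply: (vanish_on_products bacd) => e {}x; apply: D0.
Qed.

Hypothesis Tder : forall a b x, T (a ** b) x = T a (b ** x) + T b (a ** x).

(** [1 - p0] and [q0] are the real and imaginary parts of a formal unitary
    [u = 1 - p0 + i q0].  The imaginary unit need not exist in [K], so powers of
    [u] [u] are handled as pairs [(p, q)]. *)
Section Rotation.
Variables p0 q0 : E.
Hypotheses (p0s : star p0 = p0) (q0s : star q0 = q0).
Hypothesis unitary0 : p0 ** p0 + q0 ** q0 = p0 + p0.

(** If [u = exp (i t)] then [T u = i u w] with [w] the derivative of [t];
    solving for [w] gives this expression. *)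
Let w x := T q0 (x - p0 ** x) + T p0 (q0 ** x).

Let wD x y : w (x + y) = w x + w y.
Proof. by rewrite /w !mulEDr opprD addrACA !(formDr HT); ring. Qed.

Let wN x : w (- x) = - w x.
Proof.
rewrite /w (_ : - x - _ = - (x - p0 ** x)); last by algebra.
rewrite (_ : q0 ** - x = - (q0 ** x)); last by algebra.
by rewrite !(formNr HT); ring.
Qed.

Let unitary0' : emb q0 * emb q0 = emb p0 + emb p0 - emb p0 * emb p0.
Proof. by have := congr1 emb unitary0; rewrite !embE => <-; ring. Qed.

Let sum_sq x : T p0 x = T p0 (p0 ** x) + T q0 (q0 ** x).
Proof.
have := formDl HT (p0 ** p0) (q0 ** q0) x.
by rewrite unitary0 (formDl HT) !Tder addrACA => /double_inj.
Qed.

Let q0q x : q0 ** (q0 ** x) = p0 ** x + p0 ** x - p0 ** (p0 ** x).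
Proof. by apply: emb_inj; rewrite !embE mulrA unitary0'; ring. Qed.

Let Tp0 x : T p0 x = w (q0 ** x).
Proof.
rewrite /w q0q !(formBr HT) !(formDr HT).
rewrite (_ : p0 ** (q0 ** x) = q0 ** (p0 ** x)); last by algebra.
by have := sum_sq x; have := sum_sq (p0 ** x) => -> ->; ring.
Qed.

Let Tq0 x : T q0 x = w (x - p0 ** x).
Proof.
rewrite /w (_ : x - _ - _ = x - q0 ** (q0 ** x)); last by rewrite q0q; algebra.
rewrite (_ : q0 ** (x - _) = q0 ** x - p0 ** (q0 ** x)); last by algebra.
rewrite !(formBr HT).
by have := sum_sq (q0 ** x) => ->; ring.
Qed.

(** [T (u ^ n) = n u ^ (n - 1) T u]. *)
Lemma rotation_power n : exists p q,
  [/\ star p = p, star q = q, p ** p + q ** q = p + p,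
   forall x, T p x = n%:R * w (q ** x) & forall x, T q x = n%:R * w (x - p ** x)].
Proof.
elim: n => [|n [p [q [ps qs pq Tp Tq]]]].
  by exists 0, 0; split=> [|||x|x]; rewrite ?star0 ?mulE0 // (form0l HT) mul0r.
exists (p + p0 - p ** p0 + q ** q0), (q + q0 - q ** p0 - q0 ** p); split.
- by rewrite !(starD HE) starN !(starM HE) ps p0s qs q0s.
- by rewrite !(starD HE) !starN !(starM HE) ps p0s qs q0s.
- have u1 := congr1 emb pq; rewrite !embE in u1.
  have uq : emb q * emb q = emb p + emb p - emb p * emb p by rewrite -u1; ring.
  by apply: emb_inj; rewrite !embE; ring: unitary0' uq.
- move=> x; rewrite !(formDl HT) (formNl HT) !Tder !Tp !Tq !Tp0 !Tq0 -natr1.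
  rewrite (_ : (q + q0 - q ** p0 - q0 ** p) ** x =
    q ** x + q0 ** x - q ** (p0 ** x) - q0 ** (p ** x)); last by algebra.
  rewrite (_ : p ** (q0 ** x) = q0 ** (p ** x)); last by algebra.
  rewrite (_ : p0 ** (q ** x) = q ** (p0 ** x)); last by algebra.
  by rewrite !wD !wN; ring.
move=> x; rewrite !(formDl HT) !(formNl HT) !Tder !Tp !Tq !Tp0 !Tq0 -natr1.
rewrite (_ : x - (p + p0 - p ** p0 + q ** q0) ** x =
  x - p ** x - p0 ** x + p ** (p0 ** x) - q ** (q0 ** x)); last by algebra.
rewrite (_ : q0 ** (q ** x) = q ** (q0 ** x)); last by algebra.
rewrite (_ : p0 ** (p ** x) = p ** (p0 ** x)); last by algebra.
by rewrite !wD !wN; ring.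
Qed.

(** The powers of a unitary are bounded, whereas their derivatives grow like
    [n]. *)
Lemma rotation_vanish x : T p0 x = 0 /\ T q0 x = 0.
Proof.
suff w0 y : w y = 0.
  by rewrite Tp0 Tq0 !w0.
apply: (@ab_small0 _ 0) => e _; rewrite mul0r.
apply: (@ler0_archi _ _ (10 * M * nu y)) => n.
have [p [q [ps qs pq Tp Tq]]] := rotation_power n.
have nwE : n%:R * w y = T q (y - p ** y) + T p (q ** y).
  rewrite Tp Tq -mulrDr -wD; congr (_ * w _).
  have u1 := congr1 emb pq; rewrite !embE in u1.
  have uq : emb q * emb q = emb p + emb p - emb p * emb p by rewrite -u1; ring.
  by apply: emb_inj; rewrite !embE; ring: uq.
have pp : nu (p + p) <= nu p + nu p := nuD HE p p.
have p2 : nu p <= 2.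
  by have := nu_sumsq HE ps qs; rewrite pq expr2; have := nu_ge0 HE p; nra.
have q2 : nu q <= 2.
  have := nu_sumsq HE qs ps; rewrite addrC pq expr2; have := nu_ge0 HE q; nra.
rewrite -[n%:R]normr_nat -(ab_real HK) rmorph_nat -(abM HK) nwE.
have M0 := form_bound_ge0 HT; have y0 := nu_ge0 HE y.
have py : nu (y - p ** y) <= 3 * nu y.
  by rewrite (le_trans (nuB _ _)) //; have := nuM HE p y; nra.
have qy : nu (q ** y) <= 2 * nu y.
  by rewrite (le_trans (nuM HE _ _)) //; nra.
have a1 : nu q * nu (y - p ** y) <= 6 * nu y.
  by have := nu_ge0 HE q; have := nu_ge0 HE (y - p ** y); nra.
have a2 : nu p * nu (q ** y) <= 4 * nu y.
  by have := nu_ge0 HE p; have := nu_ge0 HE (q ** y); nra.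
rewrite (le_trans (abD HK _ _)) //.
have := form_bound HT q (y - p ** y); have := form_bound HT p (q ** y).
by have := ler_wpM2l M0 a1; have := ler_wpM2l M0 a2; lra.
Qed.

End Rotation.

(** [T] vanishes on the Cayley transform of [h], from which [h] is recovered by
    a rational expression. *)
Lemma derivation_selfadjoint h x : star h = h -> T h x = 0.
Proof.
move=> hs; have [g Hg] := resolvent_exists hs.
have gs := resolvent_star hs Hg.
have E1 := congr1 emb (resolventE Hg); rewrite !embE in E1.
pose f := h - h ** g; have fs : star f = f by rewrite /f starB (starM HE) hs gs.
have Tgf y : T g y = 0 /\ T f y = 0.
  have gs2 : star (g + g) = g + g by rewrite (starD HE) gs.
  have fs2 : star (f + f) = f + f by rewrite (starD HE) fs.
  have unitary : (g + g) ** (g + g) + (f + f) ** (f + f) = g + g + (g + g).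
    rewrite /f; apply: emb_inj; rewrite !embE.
    rewrite (_ : _ + _ = 4 * (emb g * emb g)
      + 4 * (emb h * emb h - emb h * emb h * emb g) * (1 - emb g)); last by ring.
    by rewrite -{1}E1 addrK; ring.
  have [a b] := rotation_vanish gs2 fs2 unitary y.
  by rewrite (formDl HT g) in a; rewrite (formDl HT f) in b; split; apply: double_eq0.
have Thg y : T h (y - g ** y) = 0.
  have [_ ] := Tgf y; rewrite /f (formBl HT) Tder (formBr HT) => H0.
  have [Tg _] := Tgf (h ** y); rewrite Tg addr0 in H0; exact: H0.
rewrite -[RHS](Thg (x + h ** h ** x)); congr (T h _).
apply: emb_inj; rewrite !embE.
by move: Hg; rewrite /resolvent => Hg1; rewrite -[LHS]mul1r -Hg1; ring.
Qed.

(** A skew element [k] is approximated by [e k] with [e = k m] self-adjoint, and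
    [T (e k) x] is half of [T (k ^ 2) (m x)], where [k ^ 2] is self-adjoint. *)
Lemma derivation_zero a x : T a x = 0.
Proof.
have sa := derivation_selfadjoint.
have skew k : star k = - k -> T k x = 0.
  move=> ks; apply: (@ab_small0 _ (M * nu x)) => eps eps0.
  have [e [m [em es _ He]]] := approximate_unit k eps0.
  have Tek : T (e ** k) x = 0.
    rewrite Tder (sa _ _ es) add0r em.
    by rewrite -mulEA; apply: double_eq0; rewrite -(Tder k k); apply: sa;
      rewrite (starM HE) ks; algebra.
  rewrite -[k](subrK (e ** k)) (formDl HT) Tek addr0.
  rewrite (le_trans (form_bound HT _ _)) //.
  rewrite -mulrA ler_wpM2l ?(form_bound_ge0 HT) // mulrC ler_wpM2l //.
  exact: nu_ge0 HE _.
apply: double_eq0; rewrite -(formDl HT).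
rewrite (_ : a + a = a + star a + (a - star a)); last by algebra.
rewrite (formDl HT) sa ?skew ?addr0 //.
  by rewrite starB (starK HE) opprB.
by rewrite (starD HE) (starK HE) addrC.
Qed.

End Derivations.

(** ** Balanced forms are small far along the approximate unit *)

(** Formally, [S a x = psi (a ** x)] for a functional [psi] on the algebra. *)
Definition balanced (S : E -> E -> K) : Prop :=
  forall a b x, S a (b ** x) = S b (a ** x).

Definition join e e' := e + e' - e ** e'.

Lemma emb_join e e' : 1 - emb (join e e') = (1 - emb e) * (1 - emb e').
Proof. by rewrite /join !embE; ring. Qed.

Lemma joinA : associative join.
Proof. by move=> x y z; rewrite /join; algebra. Qed.

Lemma joinC : commutative join.
Proof. by move=> x y; rewrite /join; algebra. Qed.

Lemma join_contraction e e' : contraction (1 - emb e) ->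
  contraction (1 - emb e') -> contraction (1 - emb (join e e')).
Proof. by rewrite emb_join; apply: contractionM. Qed.

Lemma join_sub e e' x : contraction (1 - emb e') ->
  nu (x - join e e' ** x) <= nu (x - e ** x).
Proof.
by move=> He'; rewrite -!act_sub1 emb_join mulrC actM (le_trans (He' _)).
Qed.

Lemma nu_contraction e : contraction (1 - emb e) -> nu e <= 2.
Proof.
move=> He; have := He (star e); rewrite act_sub1 nu_star => H1.
have : nu (star e) + nu (star e - e ** star e) >= nu (e ** star e).
  rewrite -(nuN (star e - _)) (le_trans _ (nuD HE _ _)) //.
  by rewrite opprB addrC subrK.
by move: H1; rewrite (mulEC e) (nu_cstar HE) expr2 nu_star; have := nu_ge0 HE e; nra.
Qed.

Section Balanced.
Variables (S : E -> E -> K) (M : R) (HS : bounded_form S M) (bal : balanced S).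

(** [s] is the value at [z] of the functional behind [S], that is the limit of
    [S e z] along the approximate unit.  [join] directs the approximate unit. *)
Definition form_limit (z : E) (s : K) : Prop :=
  exists C, forall eta, 0 < eta -> exists2 e, contraction (1 - emb e) &
    forall e', contraction (1 - emb e') -> ab (s - S (join e e') z) <= C * eta.

Lemma form_limit_product a y : form_limit (a ** y) (S a y).
Proof.
exists (M * nu a) => eta eta0.
have [e [m [_ _ He ye]]] := approximate_unit y eta0.
exists e => // e' He'; rewrite bal -(formBr HS) (le_trans (form_bound HS _ _)) //.
rewrite mulrA ler_wpM2l ?mulr_ge0 ?(form_bound_ge0 HS) ?(nu_ge0 HE) //.
by rewrite (le_trans (join_sub e y He')).
Qed.

Lemma form_limitD z1 s1 z2 s2 : form_limit z1 s1 -> form_limit z2 s2 ->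
  form_limit (z1 + z2) (s1 + s2).
Proof.
move=> [C1 H1] [C2 H2]; exists (C1 + C2) => eta eta0.
have [e1 ce1 He1] := H1 _ eta0; have [e2 ce2 He2] := H2 _ eta0.
exists (join e1 e2) => [|e' ce']; first exact: join_contraction.
rewrite (formDr HS) opprD addrACA (le_trans (abD HK _ _)) // mulrDl lerD //.
  by rewrite -joinA He1 //; apply: join_contraction.
by rewrite (joinC e1) -joinA He2 //; apply: join_contraction.
Qed.

Lemma form_limit_bound z s : form_limit z s -> ab s <= 2 * M * nu z.
Proof.
move=> [C H]; rewrite -subr_le0; apply: (@ler0_eps _ _ C) => eta eta0.
have [e ce He] := H _ eta0; have := He _ ce.
have := abD HK (s - S (join e e) z) (S (join e e) z); rewrite subrK.
have := form_bound HS (join e e) z.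
have := nu_contraction (join_contraction ce ce).
have := form_bound_ge0 HS; have := nu_ge0 HE z => z0 M0 j2.
have : M * (nu (join e e) * nu z) <= M * (2 * nu z).
  by rewrite ler_wpM2l // ler_wpM2r.
lra.
Qed.

(** The factor [kap (ab s) / s] in the witness makes the value of [S] a positive
    real number, so that values of [S] add up without cancellation. *)
Lemma normalized_witness eps e :
  ~ (forall a x, ab (S a (x - e ** x)) <= eps * (nu a * nu x)) -> 0 < eps ->
  exists a x r, [/\ S a (x - e ** x) = kap r, eps <= r & nu a * nu x <= 1].
Proof.
move=> H eps0.
have [a [x ax]] : exists a x, eps * (nu a * nu x) < ab (S a (x - e ** x)).
  apply: contrapT => N; apply: H => a x; rewrite leNgt; apply/negP => ax.
  by apply: N; exists a, x.
set s := S a _ in ax.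
have N0 : 0 < nu a * nu x.
  rewrite lt_neqAle mulr_ge0 ?(nu_ge0 HE) // andbT eq_sym mulf_eq0.
  apply/negP => /orP[] /eqP /(nu_eq0 HE) z; move: ax; rewrite /s z.
    by rewrite (form0l HS) ab0 nu0 mul0r mulr0 ltxx.
  rewrite mulEC mulE0 subr0 -(scale0r 0) (formZr HS) mul0r ab0 scale0r nu0.
  by rewrite !mulr0 ltxx.
have s0 : s != 0.
  apply/eqP => s0; move: ax; rewrite s0 ab0; apply/negP; rewrite -leNgt.
  by rewrite mulr_ge0 // ltW.
pose N := nu a * nu x.
exists (kap (ab s / N) / s *: a), x, (ab s / N); split.
- by rewrite (formZl HS) -/s divfK.
- by rewrite ler_pdivlMr // ltW.
rewrite (nuZ HE) (abM HK) (ab_real HK) ger0_norm; last first.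
  by rewrite divr_ge0 ?(ab_ge0 HK) // ltW.
have abs0 : 0 < ab s.
  rewrite lt_neqAle (ab_ge0 HK) andbT eq_sym; apply/eqP => /(ab_eq0 HK) /eqP.
  by rewrite (negbTE s0).
have : ab s * ab s^-1 = 1.
  by rewrite -(abM HK) divff // -(rmorph1 kap) (ab_real HK) normr1.
move=> ss; rewrite (_ : _ * _ = ab s * ab s^-1 * (N^-1 * N)); last first.
  by rewrite /N; ring.
by rewrite ss mul1r mulVf // lt0r_neq0.
Qed.

(** Otherwise one finds successive products [a ** y], of norm at most 1, almost
    orthogonal to the sum [z] of the previous ones, on which the functional behind
    [S] takes values at least [eps].  The sum of [n] of them has norm
    [O (sqrt n)] by the C*-identity, while its value is at least [n * eps]. *)
Lemma form_tail_small eps : 0 < eps -> exists2 e, contraction (1 - emb e) &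
  forall a x, ab (S a (x - e ** x)) <= eps * (nu a * nu x).
Proof.
move=> eps0; apply: contrapT => H.
have build n : exists z r, [/\ form_limit z (kap r), n%:R * eps <= r
    & nu z ^+ 2 <= 2 * n%:R].
  elim: n => [|n [z [r [zr nr nz]]]].
    exists (0 ** 0), 0; split; rewrite ?mul0r //.
      rewrite rmorph0 -(form0l HS 0); exact: form_limit_product.
    by rewrite mulE0 nu0 expr0n mulr0.
  have h0 : (0 : R) < 1 / 2 by lra.
  have [e [m [_ _ ce ze]]] := approximate_unit (star z) h0.
  have [|a [x [r' [Sr epsr ax]]]] := @normalized_witness eps e _ eps0.
    by move=> He; apply: H; exists e.
  set y := x - e ** x in Sr.
  have ay : nu (a ** y) <= 1.
    rewrite (le_trans _ ax) // (le_trans (nuM HE _ _)) // ler_wpM2l ?(nu_ge0 HE) //.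
    by rewrite /y -act_sub1 ce.
  exists (z + a ** y), (r + r'); split.
  - by rewrite rmorphD -Sr; apply: form_limitD => //; apply: form_limit_product.
  - by rewrite -natr1; lra.
  (* [y] has been multiplied by [1 - e], which nearly kills [star z]. *)
  have cross : nu (star z ** (a ** y)) <= 1 / 2.
    have -> : star z ** (a ** y) = (star z - e ** star z) ** (a ** x).
      by rewrite /y; algebra.
    rewrite (le_trans (nuM HE _ _)) //.
    have := nuM HE a x; have := nu_ge0 HE (star z - e ** star z).
    have := nu_ge0 HE (a ** x); nra.
  rewrite -(nu_cstar HE).
  have -> : star (z + a ** y) ** (z + a ** y) = star z ** z +
      star (a ** y) ** (a ** y) + (star z ** (a ** y) + star (star z ** (a ** y))).
    by rewrite (starM HE (star z)) (starK HE) (starD HE); algebra.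
  have := nuD HE (star z ** z + star (a ** y) ** (a ** y))
    (star z ** (a ** y) + star (star z ** (a ** y))).
  have := nuD HE (star z ** z) (star (a ** y) ** (a ** y)).
  have := nuD HE (star z ** (a ** y)) (star (star z ** (a ** y))).
  rewrite nu_star !(nu_cstar HE) -natr1; have := nu_ge0 HE (a ** y); nra.
suff : eps ^+ 2 <= 0 by apply/negP; rewrite -ltNge exprn_gt0.
apply: (@ler0_archi _ _ (8 * M ^+ 2)) => n.
have [z [r [/form_limit_bound zr nr nz]]] := build n.
rewrite (ab_real HK) in zr; have := ler_norm r => rr.
have M0 := form_bound_ge0 HS; have z0 := nu_ge0 HE z.
have ne0 : 0 <= n%:R * eps by rewrite mulr_ge0 // ltW.
have : (n%:R * eps) ^+ 2 <= (2 * M * nu z) ^+ 2.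
  by rewrite ler_pXn2r // ?nnegrE ?mulr_ge0 //; lra.
rewrite !exprMn => le1.
have : M ^+ 2 * nu z ^+ 2 <= M ^+ 2 * (2 * n%:R) by rewrite ler_wpM2l ?sqr_ge0.
case: n => [|n] in nz nr ne0 le1 *.
  by move=> _; rewrite mul0r mulr_ge0 ?sqr_ge0.
have n0 : (0 : R) < n.+1%:R by [].
move=> le2; rewrite -(ler_pM2l n0); move: le1 le2.
by set N : R := n.+1%:R; rewrite !expr2; lra.
Qed.

End Balanced.

(** ** Factorization of balanced forms *)

Lemma triple_balanced S M : bounded_form S M ->
  (forall a b c x, S a (b ** c ** x) = S b (a ** c ** x)) -> balanced S.
Proof.
move=> HS H a b x.
have ba : bounded_additive (fun y => S a (b ** y) - S b (a ** y)).
  apply: bounded_additiveB.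
    exact: (bounded_additive_mul b (form_bounded_additive HS a)).
  exact: (bounded_additive_mul a (form_bounded_additive HS b)).
apply/eqP; rewrite -subr_eq0; apply/eqP; apply: (vanish_on_products ba) => c y.
by rewrite !mulEA H subrr.
Qed.

(** One step of Cohen's construction.  The factor [rho ^ n + beta] of the
    unitization is multiplied by [1 - (1 - e) / 8 = 7/8 (1 + e / 7)], the form is
    divided by it, and [e] is chosen so that [1 - e] is small both on [beta] and
    against the form.  Hence both change by [O (rho ^ n)], and the scalar part of
    the factor tends to 0. *)
Lemma geometric_factor_step (S : E -> E -> K) M (beta : E) n :
  bounded_form S M -> balanced S ->
  exists S' beta', [/\ exists M', bounded_form S' M', balanced S',
    forall a x, S a (kap (rho R ^+ n) *: x + beta ** x) =
      S' a (kap (rho R ^+ n.+1) *: x + beta' ** x),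
    forall a x, ab (S' a x - S a x) <= nu a * nu x * rho R ^+ n
    & nu (beta' - beta) <= 1 * rho R ^+ n].
Proof.
move=> HS bal; have r0 := rho_gt0 R n.
have [e1 ce1 tail1] := form_tail_small HS bal r0.
have [e2 [m [_ _ ce2 beta2]]] := approximate_unit beta r0.
pose e := join e1 e2; have ce : contraction (1 - emb e) by apply: join_contraction.
have tail a x : ab (S a (x - e ** x)) <= rho R ^+ n * (nu a * nu x).
  rewrite -act_sub1 /e emb_join actM !act_sub1.
  rewrite (le_trans (tail1 a _)) // ler_wpM2l ?ler_wpM2l ?(nu_ge0 HE) ?(ltW r0) //.
  by rewrite -act_sub1 ce2.
have betae : nu (beta - e ** beta) <= rho R ^+ n.
  by rewrite /e joinC (le_trans (join_sub e2 beta ce1)).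
clearbody e; have e2' := nu_contraction ce.
have ke : nu (kap (1 / 7) *: e) <= 1 / 2 by rewrite nuZr; lra.
have [q [q1 Hq]] := quasi_inverse ke; rewrite embZ in Hq.
have k87 : kap (8 / 7) = 1 + kap (1 / 7).
  by rewrite -(rmorph1 kap) -rmorphD; congr (kap _); lra.
have k78 : kap (8 / 7) * kap (7 / 8) = 1.
  by rewrite -rmorphM -[RHS](rmorph1 kap); congr (kap _); lra.
have sk78 : scal (kap (8 / 7)) * scal (kap (7 / 8)) = 1 by rewrite -scalM k78.
have sk87 : scal (kap (8 / 7)) = 1 + scal (kap (1 / 7)) by rewrite k87 scalD.
have k18 : kap (1 / 8) = kap (1 / 7) * kap (7 / 8).
  by rewrite -rmorphM; congr (kap _); lra.
have sk18 : scal (kap (1 / 8)) = scal (kap (1 / 7)) * scal (kap (7 / 8)).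
  by rewrite k18 scalM.
have sk78' : scal (kap (7 / 8)) + scal (kap (1 / 8)) = 1.
  by rewrite -scalD -rmorphD -scal1 -(rmorph1 kap); congr (scal (kap _)); lra.
exists (fun a x => S a (kap (8 / 7) *: (x - q ** x))).
exists (beta - kap (1 / 8) *: (beta - e ** beta)
  + kap (1 / 8) *: (kap (rho R ^+ n) *: e)); split.
- exists (8 / 7 * (M * 2)); split.
  + by move=> x y z; rewrite (formDl HS).
  + by move=> x y z; rewrite -(formDr HS); congr (S x _); algebra.
  + by move=> c x y; rewrite (formZl HS).
  + by move=> c x y; rewrite -(formZr HS); congr (S x _); algebra.
  + by have := form_bound_ge0 HS; lra.
  move=> x y; rewrite (le_trans (form_bound HS _ _)) // nuZr; last lra.
  have : nu (y - q ** y) <= 2 * nu y.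
    rewrite (le_trans (nuB _ _)) //.
    by have := nuM HE q y; have := nu_ge0 HE y; nra.
  move=> /(ler_wpM2l (mulr_ge0 (form_bound_ge0 HS) (nu_ge0 HE x))); lra.
- move=> a b x.
  rewrite (_ : _ *: _ = b ** (kap (8 / 7) *: (x - q ** x))); last by algebra.
  by rewrite bal; congr (S b _); algebra.
- move=> a x; congr (S a _); apply: emb_inj.
  have -> : kap (rho R ^+ n.+1) = kap (7 / 8) * kap (rho R ^+ n).
    by rewrite exprS rmorphM.
  rewrite !embE scalM.
  set L := scal (kap (rho R ^+ n)); set c := scal (kap (7 / 8)) in sk78 sk18 sk78' *.
  set d := scal (kap (1 / 7)) in Hq sk18 *; set c' := scal (kap (8 / 7)) in sk78 *.
  (* [c (1 + d e) = 1 - (1 - e) / 8] is the factor that passes from the form to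
     the element; [c' (1 - q)] is its inverse. *)
  transitivity (c' * (1 - emb q) * emb x * (c * (1 + d * emb e) * (L + emb beta))).
    transitivity (c' * c * (L + emb beta) * emb x * ((1 + d * emb e) * (1 - emb q))).
      by rewrite sk78 Hq; ring.
    by ring.
  rewrite (_ : c * (1 + d * emb e) * (L + emb beta) =
    c * (L + emb beta) + d * c * emb e * (L + emb beta)); last by ring.
  have cE : c = 1 - scal (kap (1 / 8)) by rewrite -sk78' addrK.
  by rewrite -sk18 cE; ring.
- move=> a x; rewrite -(formBr HS).
  have [y yE] : exists y, y = x - q ** x by exists (x - q ** x).
  have xE : emb x = emb y + scal (kap (1 / 7)) * (emb e * emb y).
    transitivity (((1 + scal (kap (1 / 7)) * emb e) * (1 - emb q)) * emb x).
      by rewrite Hq mul1r.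
    by rewrite yE !embE; ring.
  rewrite -yE (_ : _ - x = kap (1 / 7) *: (y - e ** y)); last first.
    by apply: emb_inj; rewrite !embE xE sk87; ring.
  rewrite (formZr HS) (abM HK) (ab_real HK) ger0_norm; last lra.
  have y2 : nu y <= 2 * nu x.
    rewrite yE (le_trans (nuB _ _)) //.
    by have := nuM HE q x; have := nu_ge0 HE x; nra.
  have := tail a y; have := ler_wpM2l (mulr_ge0 (ltW r0) (nu_ge0 HE a)) y2.
  have := mulr_ge0 (mulr_ge0 (ltW r0) (nu_ge0 HE a)) (nu_ge0 HE x).
  lra.
rewrite (_ : _ - _ = kap (1 / 8) *: (kap (rho R ^+ n) *: e - (beta - e ** beta)));
  last by algebra.
rewrite nuZr; last lra.
have := nuB (kap (rho R ^+ n) *: e) (beta - e ** beta).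
rewrite (nuZr _ (ltW r0)); have := ler_wpM2l (ltW r0) e2'; lra.
Qed.

Definition geom_cvg (u : nat -> K) (l : K) : Prop :=
  exists C, forall n, ab (u n - l) <= C * rho R ^+ n.

Lemma geom_cvg_uniq u v l l' : geom_cvg u l -> geom_cvg v l' ->
  (forall n, u n = v n) -> l = l'.
Proof.
move=> [C Hu] [C' Hv] uv; apply/eqP; rewrite -subr_eq0; apply/eqP/(ab_eq0 HK).
apply/eqP; rewrite eq_le (ab_ge0 HK) andbT; apply: (@ler0_geom _ _ (C + C')) => n.
have := abD HK (- (u n - l)) (v n - l'); rewrite abN opprB uv subrKA => /le_trans.
by apply; rewrite mulrDl lerD // -uv.
Qed.

Lemma geom_cvgD u v l l' : geom_cvg u l -> geom_cvg v l' ->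
  geom_cvg (fun n => u n + v n) (l + l').
Proof.
move=> [C Hu] [C' Hv]; exists (C + C') => n; rewrite opprD addrACA mulrDl.
by rewrite (le_trans (abD HK _ _)) // lerD.
Qed.

Lemma geom_cvgZ c u l : geom_cvg u l -> geom_cvg (fun n => c * u n) (c * l).
Proof.
move=> [C Hu]; exists (ab c * C) => n; rewrite -mulrBr (abM HK) -mulrA.
by rewrite ler_wpM2l ?(ab_ge0 HK).
Qed.

(** Cohen's factorization theorem for balanced forms, as the limit of
    [geometric_factor_step]. *)
Lemma balanced_factorization S M : bounded_form S M -> balanced S ->
  exists Th M' b, [/\ bounded_form Th M', balanced Th
    & forall a x, S a x = Th a (b ** x)].
Proof.
move=> HS bal.
pose X := {p : (E -> E -> K) * E | (exists M, bounded_form p.1 M) /\ balanced p.1}.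
pose step n (s s' : X) :=
  let: (S1, beta) := sval s in let: (S2, beta') := sval s' in
  [/\ forall a x, S1 a (kap (rho R ^+ n) *: x + beta ** x) =
      S2 a (kap (rho R ^+ n.+1) *: x + beta' ** x),
    forall a x, ab (S2 a x - S1 a x) <= nu a * nu x * rho R ^+ n
    & nu (beta' - beta) <= 1 * rho R ^+ n].
have stepP (ns : nat * X) : exists s', step ns.1 ns.2 s'.
  case: ns => n [[S1 beta] /= [[M1 H1] bal1]].
  have [S2 [beta2 [H2 bal2 a1 a2 a3]]] := geometric_factor_step beta n H1 bal1.
  by exists (exist _ (S2, beta2) (Logic.conj H2 bal2)).
have [f Hf] := choice stepP.
pose u := fix u n : X := if n is n'.+1 then f (n', u n') else
  exist _ (S, 0) (Logic.conj (ex_intro _ M HS) bal).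
have Hu n : step n (u n) (u n.+1) by exact: Hf (n, u n).
pose Sn n := (sval (u n)).1; pose bn n := (sval (u n)).2.
have HS' n : exists M, bounded_form (Sn n) M by case: (svalP (u n)).
have bal' n : balanced (Sn n) by case: (svalP (u n)).
have {Hu} Hu n : [/\ forall a x, Sn n a (kap (rho R ^+ n) *: x + bn n ** x) =
      Sn n.+1 a (kap (rho R ^+ n.+1) *: x + bn n.+1 ** x),
    forall a x, ab (Sn n.+1 a x - Sn n a x) <= nu a * nu x * rho R ^+ n
    & nu (bn n.+1 - bn n) <= 1 * rho R ^+ n].
  have := Hu n; rewrite /step /Sn /bn.
  by case: (sval (u n)) (sval (u n.+1)) => [? ?] [? ?].
have SE n a x : S a x = Sn n a (kap (rho R ^+ n) *: x + bn n ** x).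
  elim: n => [|n ->]; last by case: (Hu n).
  by rewrite /Sn /bn /= expr0 rmorph1 scale1r mulE0 addr0.
have [b Hb] : exists b, forall n, nu (bn n - b) <= 8 * 1 * rho R ^+ n.
  apply: (geom_limit (nuD HE) nuN nu0 (nu_complete HE)) => n.
  by case: (Hu n).
have lim (ax : E * E) : exists l, forall n,
    ab (Sn n ax.1 ax.2 - l) <= 8 * (nu ax.1 * nu ax.2) * rho R ^+ n.
  apply: (geom_limit (abD HK) abN ab0 (ab_complete HK)) => n.
  by case: (Hu n).
have [Th' HTh'] := choice lim; pose Th a x := Th' (a, x).
have HTh n a x : ab (Sn n a x - Th a x) <= 8 * (nu a * nu x) * rho R ^+ n.
  exact: HTh' (a, x) n.
have cvg a x : geom_cvg (fun n => Sn n a x) (Th a x).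
  by exists (8 * (nu a * nu x)) => n; apply: HTh.
have ThB : bounded_form Th (M + 8).
  split.
  - move=> x y z.
    apply: (geom_cvg_uniq (cvg _ _) (geom_cvgD (cvg x z) (cvg y z))) => n.
    by have [M' Hn] := HS' n; rewrite (formDl Hn).
  - move=> x y z.
    apply: (geom_cvg_uniq (cvg _ _) (geom_cvgD (cvg x y) (cvg x z))) => n.
    by have [M' Hn] := HS' n; rewrite (formDr Hn).
  - move=> c x y; apply: (geom_cvg_uniq (cvg _ _) (geom_cvgZ c (cvg x y))) => n.
    by have [M' Hn] := HS' n; rewrite (formZl Hn).
  - move=> c x y; apply: (geom_cvg_uniq (cvg _ _) (geom_cvgZ c (cvg x y))) => n.
    by have [M' Hn] := HS' n; rewrite (formZr Hn).
  - by have := form_bound_ge0 HS; lra.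
  move=> x y; have := HTh 0%N x y; rewrite expr0 mulr1.
  have := abD HK (- (Sn 0%N x y - Th x y)) (Sn 0%N x y); rewrite abN opprB subrK.
  by have := form_bound HS x y; rewrite /Sn /=; lra.
exists Th, (M + 8), b; split=> //.
  by move=> a a' x; apply: (geom_cvg_uniq (cvg _ _) (cvg _ _)) => n; apply: bal'.
move=> a x.
have cst : geom_cvg (fun=> S a x) (S a x).
  by exists 0 => n; rewrite subrr ab0 mul0r.
apply: (geom_cvg_uniq cst _ (fun=> erefl)).
pose C0 := 8 * (nu a * nu x) + (M + 8) * (nu a * nu x).
pose C1 := 8 * (nu a * ((8 + nu b) * nu x)) + (M + 8) * (nu a * (8 * nu x)).
exists (C0 + C1) => n; have [Mn Hn] := HS' n; rewrite (SE n).
set r := rho R ^+ n; have r0 : 0 < r := rho_gt0 R n.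
have r1 : r <= 1 by rewrite exprn_ile1 // /rho; lra.
have a0 := nu_ge0 HE a; have x0 := nu_ge0 HE x; have M8 := form_bound_ge0 ThB.
have ax0 := mulr_ge0 a0 x0.
rewrite (formDr Hn) (formZr Hn) -addrA mulrDl (le_trans (abD HK _ _)) // lerD //.
  rewrite (abM HK) (ab_real HK) gtr0_norm // mulrC ler_wpM2r ?(ltW r0) //.
  have := HTh n a x; have := form_bound ThB a x.
  have := abD HK (Sn n a x - Th a x) (Th a x); rewrite subrK -/r /C0.
  have := ler_wpM2l ax0 r1; lra.
have bx : nu (bn n ** x) <= (8 + nu b) * nu x.
  rewrite (le_trans (nuM HE _ _)) // ler_wpM2r //.
  by have := nuD HE (bn n - b) b; rewrite subrK; have := Hb n; rewrite -/r; lra.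
have dx : nu ((bn n - b) ** x) <= 8 * nu x * r.
  rewrite (le_trans (nuM HE _ _)) // mulrAC ler_wpM2r //.
  by have := Hb n; rewrite mulr1.
rewrite (_ : _ - _ = (Sn n a (bn n ** x) - Th a (bn n ** x))
  + Th a ((bn n - b) ** x)); last first.
  rewrite (_ : (bn n - b) ** x = bn n ** x - b ** x); last by algebra.
  by rewrite (formBr ThB) subrKA.
rewrite /C1 mulrDl (le_trans (abD HK _ _)) // lerD //.
  rewrite (le_trans (HTh n a _)) // ler_wpM2r ?(ltW r0) // ler_wpM2l //.
  by rewrite ler_wpM2l.
rewrite (le_trans (form_bound ThB _ _)) // -!mulrA ler_wpM2l // ler_wpM2l //.
by rewrite mulrA.
Qed.

(** A second factorization supplies an element [b2] at which the form can be
    evaluated to obtain a functional. *)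
Lemma balanced_representation S M : bounded_form S M -> balanced S ->
  exists phi b, [/\ bounded_additive phi, forall c x, phi (c *: x) = c * phi x
    & forall a x, S a x = phi (b ** (a ** x))].
Proof.
move=> HS bal.
have [S1 [M1 [b1 [HS1 bal1 E1]]]] := balanced_factorization HS bal.
have [S2 [M2 [b2 [HS2 bal2 E2]]]] := balanced_factorization HS1 bal1.
exists (S2 b2), b1; split; first exact: (form_bounded_additive HS2).
  by move=> c x; rewrite (formZr HS2).
move=> a x; rewrite E1 E2 bal2; congr (S2 _ _); algebra.
Qed.

(** ** Ternary derivations as forms *)

Section TernaryDerivation.
Variables (B : E -> E -> K) (M : R) (HB : bounded_form B M).

Let B' a x := conj (B (star a) (star x)).

Hypothesis ternary : forall a b c x, B (a ** b ** c) x =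
  B a (b ** c ** x) + B' b (a ** c ** x) + B c (a ** b ** x).

Let HB' : bounded_form B' M.
Proof.
split=> [x y z|x y z|c x y|c x y||x y]; rewrite /B'.
- by rewrite (starD HE) (formDl HB) (sconjD HK).
- by rewrite (starD HE) (formDr HB) (sconjD HK).
- by rewrite (starZ HE) (formZl HB) (sconjM HK) (sconjK HK).
- by rewrite (starZ HE) (formZr HB) (sconjM HK) (sconjK HK).
- exact: form_bound_ge0 HB.
- by rewrite (ab_conj HK) (le_trans (form_bound HB _ _)) // !nu_star.
Qed.

Lemma form_add_adjoint (s : K) :
  bounded_form (fun a x => B a x + s * B' a x) (M + ab s * M).
Proof.
have M0 := form_bound_ge0 HB; have s0 := ab_ge0 HK s.
split=> [x y z|x y z|c x y|c x y||x y].
- by rewrite (formDl HB) (formDl HB'); ring.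
- by rewrite (formDr HB) (formDr HB'); ring.
- by rewrite (formZl HB) (formZl HB'); ring.
- by rewrite (formZr HB) (formZr HB'); ring.
- by rewrite addr_ge0 // mulr_ge0.
rewrite (le_trans (abD HK _ _)) // mulrDl lerD ?(form_bound HB) //.
by rewrite (abM HK) -mulrA ler_wpM2l // (form_bound HB').
Qed.

Let ternary' a b c x : B' (a ** b ** c) x =
  B' a (b ** c ** x) + B b (a ** c ** x) + B' c (a ** b ** x).
Proof.
rewrite /B' !(starM HE) ternary !(sconjD HK) /B' !(starM HE) !(starK HE).
by rewrite (sconjK HK).
Qed.

(** Exchanging [a] and [b] in the ternary identity shows that [B - B'] is
    balanced; adding the identity to its conjugate shows that [B + B'] is a triple
    derivation, hence 0.  So [B - B' = 2 B], and [phi] is a multiple of the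
    functional that represents it. *)
Lemma ternary_derivation_representation : exists phi b,
  [/\ bounded_additive phi, forall c x, phi (c *: x) = c * phi x
    & forall a x, B a x =
      conj (phi (star (star b ** (a ** x)))) - phi (b ** (a ** x))].
Proof.
have HT := form_add_adjoint 1; have HS := form_add_adjoint (- 1).
have T3 := triple_derivation_derivation HT.
have T0 a x : B a x + 1 * B' a x = 0.
  apply: (derivation_zero HT); apply: T3 => {}a b c {}x.
  by rewrite ternary ternary'; ring.
have B'E a x : B' a x = - B a x.
  by apply/eqP; rewrite -addr_eq0 addrC -[B' a x]mul1r T0.
have bal := triple_balanced HS.
have [phi [b [phib phiZ Hphi]]] : exists phi b, [/\ bounded_additive phi,
    forall c x, phi (c *: x) = c * phi x
    & forall a x, B a x + -1 * B' a x = phi (b ** (a ** x))].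
  apply: (balanced_representation HS); apply: bal => a b c x.
  have := ternary a b c x; rewrite (mulEC a b) ternary => /addIr e.
  apply/eqP; rewrite !mulN1r subr_eq addrAC eq_sym subr_eq.
  by apply/eqP.
(* If [psi] represents [2 B], then its adjoint represents [- 2 B], so that the
   difference of the two is [- 4 B]. *)
have quarter : kap (1 / 4) + kap (1 / 4) + kap (1 / 4) + kap (1 / 4) = 1.
  by rewrite -!rmorphD -(rmorph1 kap); congr (kap _); lra.
have phiE a x : phi (b ** (a ** x)) = B a x + B a x.
  by rewrite -Hphi B'E; ring.
have phiE' a x : conj (phi (star (star b ** (a ** x)))) = - (B a x + B a x).
  by rewrite !(starM HE) (starK HE) phiE (sconjD HK) -/(B' a x) B'E opprD.
exists (fun x => kap (- (1 / 4)) * phi x), b; split.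
- case: phib => phiD [N phiN]; split=> [x y|]; first by rewrite phiD mulrDr.
  exists (1 / 4 * N) => x; rewrite (abM HK) (ab_real HK) normrN ger0_norm; last lra.
  by have := phiN x; lra.
- by move=> c x; rewrite phiZ mulrCA.
move=> a x; rewrite (sconjM HK) (sconj_real HK) phiE phiE' rmorphN.
by rewrite -[LHS]mul1r -quarter; ring.
Qed.

End TernaryDerivation.

End CommutativeCstar.

(** * Normed spaces over the real and the complex numbers *)

Section Bridge.
Local Open Scope classical_set_scope.
Variables (R : realType) (K : numFieldType) (kap : {rmorphism R -> K}).
Variables (ab : K -> R).
Hypothesis kap_le : forall x y, (kap x <= kap y) = (x <= y).
Hypothesis abE : forall z : K, `|z| = kap (ab z).

Let kap_inj : injective kap. Proof. exact: fmorph_inj. Qed.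
Let kap_lt x y : (kap x < kap y) = (x < y).
Proof. by rewrite !lt_neqAle kap_le (inj_eq kap_inj). Qed.

Lemma norm_kap r : `|kap r| = kap `|r|.
Proof.
case: (lerP 0 r) => r0.
  by rewrite (ger0_norm r0) ger0_norm // -(rmorph0 kap) kap_le.
by rewrite (ltr0_norm r0) ltr0_norm ?rmorphN // -(rmorph0 kap) kap_lt.
Qed.

Section Norm.
Variables (E : normedModType K) (nu : E -> R).
Hypothesis nuE : forall x, `|x| = kap (nu x).

Lemma real_norm_ge0 x : 0 <= nu x.
Proof. by rewrite -kap_le rmorph0 -nuE. Qed.

Lemma real_norm_eq0 x : nu x = 0 -> x = 0.
Proof. by move=> x0; apply/eqP; rewrite -normr_eq0 nuE x0 rmorph0. Qed.

Lemma real_norm_triangle x y : nu (x + y) <= nu x + nu y.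
Proof. by rewrite -kap_le rmorphD -!nuE ler_normD. Qed.

Lemma real_normZ c x : nu (c *: x) = ab c * nu x.
Proof. by apply: kap_inj; rewrite rmorphM -!nuE -abE normrZ. Qed.

End Norm.

Lemma banach_geom_complete (E : completeNormedModType K) (nu : E -> R) :
  (forall x, `|x| = kap (nu x)) -> geom_complete nu.
Proof.
move=> nuE C u H.
have nu0 : nu 0 = 0 by apply: kap_inj; rewrite -nuE normr0 rmorph0.
have partial := geom_partial (real_norm_triangle nuE) nu0 H.
have C0 : 0 <= 8 * C.
  have := H 0%N; rewrite expr0 mulr1; have := real_norm_ge0 nuE (u 1%N - u 0%N).
  by move=> /le_trans h /h; lra.
have cu : cauchy (u @ \oo).
  apply: cauchy_exP => eps eps0.
  have epsE : eps = kap (ab eps) by rewrite -abE gtr0_norm.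
  have eps0' : 0 < ab eps by rewrite -kap_lt rmorph0 -epsE.
  have [n Hn] : exists n, 8 * C * rho R ^+ n < ab eps.
    apply: contrapT => N.
    have /ler0_geom : forall n, ab eps <= 8 * C * rho R ^+ n.
      by move=> n; rewrite leNgt; apply/negP => ?; apply: N; exists n.
    by rewrite leNgt eps0'.
  exists (u n); exists n => // m /= nm.
  rewrite -ball_normE /= distrC nuE epsE kap_lt (le_lt_trans _ Hn) //.
  rewrite -(subnK nm) (le_trans (partial _ _)) // ler_wpM2l //.
  by rewrite gerBl ltW // rho_gt0.
have /cauchy_cvgP/cvg_ex[l ul] := cu; exists l => e e0.
have ke0 : 0 < kap e by rewrite -(rmorph0 kap) kap_lt.
have /cvgrPdist_le/(_ _ ke0)[N _ HN] := ul.
by exists N => n /HN /=; rewrite distrC nuE kap_le.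
Qed.

Variable conj : K -> K.
Hypothesis HK : valued_scalars kap ab conj.
Variables (E : completeNormedModType K) (nu : E -> R).
Variables (mul : E -> E -> E) (star : E -> E).
Hypothesis nuE : forall x, `|x| = kap (nu x).
Hypothesis HE : comm_cstar kap ab conj mul star nu.

Lemma comm_tripleE a b c : cstar_triple mul star a b c = mul (mul a (star b)) c.
Proof.
rewrite /cstar_triple (comm_mulC HE c) (comm_mulC HE _ a) (comm_mulA HE).
by rewrite -mulr2n -[X in _ *: X]scaler_nat scalerA mulVf ?scale1r // pnatr_eq0.
Qed.

Lemma bounded_dual phi : bounded_additive ab nu phi ->
  (forall c x, phi (c *: x) = c * phi x) -> exists f : dual E, f = phi :> (E -> K).
Proof.
move=> [phiD [M phiM]] phiZ.
have phiL c x y : phi (c *: x + y) = c * phi x + phi y by rewrite phiD phiZ.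
suff pc : continuous phi by exists (Dual phiL pc).
have N0 : 0 < kap (`|M| + 1) by rewrite -(rmorph0 kap) kap_lt ltr_wpDl.
move=> x; apply/cvgrPdist_le => e e0; near=> y.
have -> : phi x - phi y = phi (x - y).
  by rewrite addrC -mulN1r -phiZ -phiD scaleN1r addrC.
rewrite (le_trans (_ : _ <= kap (`|M| + 1) * `|x - y|)) //.
  rewrite abE nuE -rmorphM kap_le (le_trans (phiM _)) //.
  by rewrite ler_wpM2r ?(real_norm_ge0 nuE) //; have := ler_norm M; lra.
rewrite mulrC -ler_pdivlMr //.
near: y; apply/nbhs_ballP; exists (e / kap (`|M| + 1)) => /=.
  exact: divr_gt0.
by move=> y; rewrite -ball_normE /= => /ltW.
Unshelve. all: by end_near.
Qed.

(** Continuity at 0 for uniform convergence on the unit ball, rescaled. *)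
Lemma derivation_bounded (delta : E -> dual E) :
  conj_linear conj delta -> norm_continuous_to_dual delta ->
  exists2 M, 0 <= M & forall a x, ab (delta a x) <= M * (nu a * nu x).
Proof.
move=> dl dc.
have conj1 : conj 1 = 1 by rewrite -(rmorph1 kap) (sconj_real HK).
have d0 x : delta 0 x = 0.
  have := dl 1 0 0; rewrite scale1r addr0 conj1 => /(congr1 (@^~ x)) /=.
  by rewrite mul1r -[LHS]addr0 => /addrI.
have dZ c a x : delta (c *: a) x = conj c * delta a x.
  have := dl c a 0; rewrite addr0 => /(congr1 (@^~ x)) /= ->.
  by rewrite d0 addr0.
have dZr (f : dual E) c x : f (c *: x) = c * f x.
  have f0 : f 0 = 0.
    have := dual_linear f 1 0 0; rewrite scale1r addr0 mul1r.
    by rewrite -[LHS]addr0 => /addrI.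
  by have := dual_linear f c x 0; rewrite !addr0 f0 addr0.
have : nbhs (0 : E) [set a | forall x, `|x| <= 1 -> `|delta a x| < 1].
  pose F := {uniform` [set x : E | `|x| <= 1] -> K}.
  have unit_nbhs : nbhs (dual_fun (delta 0) : F)
      [set h : F | forall x : E, `|x| <= 1 -> `|delta 0 x - h x| < 1].
    apply/uniform_nbhs; exists [set xy : K * K | ball xy.1 1 xy.2]; split.
      by rewrite -entourage_ballE; exists 1 => /=.
    by move=> h Hh x x1; have := Hh x x1; rewrite /= -ball_normE.
  have pre : nbhs (0 : E)
      [set a | forall x, `|x| <= 1 -> `|delta 0 x - delta a x| < 1].
    exact: dc 0 _ unit_nbhs.
  apply: filterS pre => a Ha x x1.
  by have := Ha x x1; rewrite d0 sub0r normrN.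
move=> /nbhs_ballP[r /= r0 Hr].
have rE : r = kap (ab r) by rewrite -abE gtr0_norm.
have r0' : 0 < ab r by rewrite -kap_lt rmorph0 -rE.
exists (2 / ab r); first by rewrite divr_ge0 // ltW.
move=> a x.
have [a0|a0] := eqVneq (nu a) 0.
  rewrite a0 mul0r mulr0 (real_norm_eq0 nuE a0) d0.
  by rewrite -(rmorph0 kap) (ab_real HK) normr0.
have [x0|x0] := eqVneq (nu x) 0.
  rewrite x0 !mulr0 (real_norm_eq0 nuE x0) -(scale0r 0) dZr mul0r.
  by rewrite -(rmorph0 kap) (ab_real HK) normr0.
have a1 : 0 < nu a by rewrite lt_neqAle eq_sym a0 (real_norm_ge0 nuE).
have x1 : 0 < nu x by rewrite lt_neqAle eq_sym x0 (real_norm_ge0 nuE).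
have c0 : 0 < ab r / (2 * nu a) by rewrite divr_gt0 // mulr_gt0.
have inball : ball (0 : E) r (kap (ab r / (2 * nu a)) *: a).
  rewrite -ball_normE /= sub0r normrN nuE (real_normZ nuE) (ab_real HK).
  rewrite gtr0_norm // [X in _ < X]rE kap_lt.
  have -> : ab r / (2 * nu a) * nu a = ab r / 2 by field.
  by lra.
have x'1 : `|kap (nu x)^-1 *: x| <= 1.
  rewrite nuE (real_normZ nuE) (ab_real HK) gtr0_norm ?invr_gt0 //.
  by rewrite mulVf // rmorph1.
have := Hr _ inball _ x'1.
rewrite dZ dZr (sconj_real HK) abE !(abM HK) !(ab_real HK) -(rmorph1 kap) kap_lt.
rewrite gtr0_norm // gtr0_norm ?invr_gt0 // => H.
rewrite -(ler_pM2l c0) -(ler_pM2l (_ : 0 < (nu x)^-1)) ?invr_gt0 //.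
rewrite [leLHS]mulrCA (le_trans (ltW H)) //.
rewrite le_eqVlt; apply/orP; left; apply/eqP; field.
by rewrite a0 x0 gt_eqF.
Qed.

Lemma comm_cstar_weakly_amenable :
  ternary_weakly_amenable conj (cstar_triple mul star).
Proof.
move=> delta [dl dd] dc.
have [M M0 dM] := derivation_bounded dl dc.
have mulA := comm_mulA HE; have mulC := comm_mulC HE.
have conj1 : conj 1 = 1 by rewrite -(rmorph1 kap) (sconj_real HK).
have dD a b x : delta (a + b) x = delta a x + delta b x.
  have := dl 1 a b; rewrite scale1r conj1 => /(congr1 (@^~ x)) /= ->.
  by rewrite mul1r.
have d0 x : delta 0 x = 0.
  by have := dD 0 0 x; rewrite addr0 -[LHS]addr0 => /addrI.
have dZ c a x : delta (c *: a) x = conj c * delta a x.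
  have := dl c a 0; rewrite addr0 => /(congr1 (@^~ x)) /= ->.
  by rewrite d0 addr0.
have HB : bounded_form ab nu (fun a x => delta (star a) x) M.
  split=> [x y z|x y z|c x y|c x y||x y] //.
  - by rewrite (starD HE) dD.
  - by have := dual_linear (delta (star x)) 1 y z; rewrite scale1r mul1r.
  - by rewrite (starZ HE) dZ (sconjK HK).
  - have z0 : delta (star x) 0 = 0.
      have := dual_linear (delta (star x)) 1 0 0; rewrite scale1r addr0 mul1r.
      by rewrite -[LHS]addr0 => /addrI.
    by have := dual_linear (delta (star x)) c y 0; rewrite !addr0 z0 addr0.
  by rewrite (le_trans (dM _ _)) // (nu_star HE).
have [|phi [b [phib phiZ Hphi]]] := ternary_derivation_representation HK HE HB.
  move=> a b c x; rewrite !(starM HE) (starK HE).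
  have := dd (star a) b (star c).
  rewrite comm_tripleE => /(congr1 (@^~ x)) /= ->.
  rewrite /triple_outer /triple_middle !comm_tripleE !(starK HE).
  by rewrite (mulC b a) -(mulA (star a)) (mulC (star x)) mulA.
have [f fE] := bounded_dual phib phiZ.
exists 1%N, (fun=> b), (fun=> f) => a; apply: funext => x.
rewrite big_ord1 /inner_generator /triple_middle /triple_outer !comm_tripleE fE.
rewrite -[in LHS](starK HE a) Hphi; congr (conj (phi _) - phi _).
  by rewrite !(starM HE) !(starK HE) mulC (mulC _ b) (mulC a) mulA.
by rewrite mulA.
Qed.

End Bridge.

Section Complex.
Variables (R : realType) (A : completeNormedModType R[i]).
Variables (mul : A -> A -> A) (star : A -> A).
Hypothesis HA : complex_cstar_algebra mul star.

Lemma complex_norm_star x : `|star x| = `|x|.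
Proof.
have le y : `|y| <= `|star y|.
  have := cstar_normM HA (star y) y; rewrite (cstar_norm HA) expr2.
  have [->|y0] := eqVneq y 0; first by rewrite normr0.
  by rewrite ler_pM2r // normr_gt0.
by apply/eqP; rewrite eq_le le -{2}(cstar_starK HA x) le.
Qed.

(** [v = p + i q] is normal with [star v * v = p^2 + q^2], and [p] is the average
    of [v] and [star v]. *)
Lemma complex_sumsq p q : star p = p -> star q = q -> mul p q = mul q p ->
  `|p| ^+ 2 <= `|mul p p + mul q q|.
Proof.
move=> ps qs pq; pose v := p + 'i *: q.
have mulZN (c : R[i]) x y : mul x (- (c *: y)) = - (c *: mul x y).
  by rewrite -!scaleNr (cstar_scaleAr HA).
have mulNZ (c : R[i]) x y : mul (- (c *: x)) y = - (c *: mul x y).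
  by rewrite -!scaleNr (cstar_scaleAl HA).
have vs : star v = p - 'i *: q.
  by rewrite /v (cstar_starD HA) (cstar_starZ HA) ps qs conjCi scaleNr.
have -> : mul p p + mul q q = mul (star v) v.
  rewrite vs /v (cstar_mulDl HA) !(cstar_mulDr HA) !mulNZ.
  rewrite !(cstar_scaleAr HA) pq scalerA -expr2 sqrCi scaleN1r opprK.
  by rewrite addrA addrK.
rewrite (cstar_norm HA) ler_pXn2r ?nnegrE //.
have : `|p + p| <= `|v| + `|v|.
  rewrite -{1}(complex_norm_star v) vs (le_trans _ (ler_normD _ _)) //.
  by rewrite /v addrACA addNr addr0.
by rewrite -!mulr2n normrMn lerMn2r.
Qed.

End Complex.

Section Instances.
Variable R : realType.

Lemma real_valued_scalars :
  valued_scalars (idfun : {rmorphism R -> R}) (fun x : R => `|x|) id.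
Proof.
split=> //.
- by move=> x /eqP; rewrite normr_eq0 => /eqP.
- exact: ler_normD.
- exact: normrM.
- exact: (@banach_geom_complete R R idfun (fun x => `|x|) (fun _ _ => erefl)
    (fun _ => erefl) R^o (fun x => `|x|) (fun _ => erefl)).
Qed.

Lemma real_weakly_amenable (E : completeNormedModType R) (mul : E -> E -> E)
    (star : E -> E) : real_cstar_algebra mul star -> commutative mul ->
  ternary_weakly_amenable (fun r : R => r) (cstar_triple mul star).
Proof.
move=> [A [mulA' [starA [iota [HA HI]]]]] mC.
have iD := Defs.iotaD HI; have iZ := iotaZ HI; have iM := iotaM HI.
have iS := iota_star HI; have iN := iota_norm HI.
have iota0 x : iota x = 0 -> x = 0.
  move=> x0; apply/eqP; rewrite -normr_eq0; have := iN x.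
  by rewrite x0 normr0 => /complexI <-.
have iI : injective iota.
  move=> x y xy; apply/eqP; rewrite -subr_eq0; apply/eqP/iota0.
  by rewrite iD xy -(scaleN1r y) iZ rmorphN1 scaleN1r subrr.
have leC (x y : R) : (x%:C <= y%:C)%C = (x <= y) by rewrite lecR.
apply: (@comm_cstar_weakly_amenable R R idfun (fun x => `|x|) (fun _ _ => erefl)
  (fun _ => erefl) id real_valued_scalars E (fun x => `|x|) mul star (fun _ => erefl)).
split.
- split=> //.
  + by move=> x y z; apply: iI; rewrite !iM (cstar_mulA HA).
  + by move=> x y z; apply: iI; rewrite iM !iD !iM (cstar_mulDl HA).
  + by move=> c x y; apply: iI; rewrite iM !iZ iM (cstar_scaleAl HA).
- by [].
- by move=> x /eqP; rewrite normr_eq0 => /eqP.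
- exact: ler_normD.
- exact: normrZ.
- by move=> x y; rewrite -leC rmorphM /= -!iN iM (cstar_normM HA).
- exact: (@banach_geom_complete R R idfun (fun x => `|x|) (fun _ _ => erefl)
    (fun _ => erefl) E (fun x => `|x|) (fun _ => erefl)).
- by move=> x; apply: iI; rewrite !iS (cstar_starK HA).
- by move=> x y; apply: iI; rewrite iS !iD !iS (cstar_starD HA).
- move=> c x; apply: iI; rewrite iS !iZ iS (cstar_starZ HA); congr (_ *: _).
  exact: conjc_real.
- by move=> x y; apply: iI; rewrite iS !iM !iS (cstar_starM HA) -!iS -!iM mC.
- move=> x; apply: (@complexI R); rewrite rmorphXn /= -!iN iM iS.
  exact: cstar_norm HA _.
move=> p q ps qs; rewrite -leC rmorphXn /= -!iN iD !iM.
by apply: (complex_sumsq HA); rewrite -?iS ?ps ?qs // -!iM mC.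
Qed.

Let cabs (V : normedZmodType R[i]) (x : V) : R := complex.Re `|x|.

Lemma complex_cabsE (V : normedZmodType R[i]) (x : V) : `|x| = ((cabs x)%:C)%C.
Proof.
rewrite /cabs; have := normr_ge0 x; case: `|x| => a b.
by rewrite lecE /= => /andP[/eqP -> _].
Qed.

Lemma complex_le (x y : R) : (real_complex R x <= real_complex R y) = (x <= y).
Proof. exact: lecR. Qed.

Let real_complete : geom_complete (fun x : R => `|x|).
Proof. exact: ab_complete real_valued_scalars. Qed.

Lemma cabs_le_parts (z : R[i]) : cabs z <= `|complex.Re z| + `|complex.Im z|.
Proof.
rewrite -complex_le -complex_cabsE rmorphD /= {1}(complexE z).
rewrite (le_trans (ler_normD _ _)) // normrM complexiE normCi mul1r.
by rewrite !(norm_kap complex_le).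
Qed.

Lemma cabs_ge_Re (z : R[i]) : `|complex.Re z| <= cabs z.
Proof. by rewrite -complex_le -complex_cabsE; apply: normc_ge_Re. Qed.

Lemma cabs_ge_Im (z : R[i]) : `|complex.Im z| <= cabs z.
Proof.
have := cabs_ge_Re (z * 'i%C); rewrite ReiNIm normrN => /le_trans; apply.
by rewrite -complex_le -!complex_cabsE normrM complexiE normCi mulr1.
Qed.

Lemma complex_geom_complete : geom_complete (fun z : R[i] => cabs z).
Proof.
move=> C u H.
have ReB (x y : R[i]) : complex.Re (x - y) = complex.Re x - complex.Re y.
  by case: x y => ? ? [].
have ImB (x y : R[i]) : complex.Im (x - y) = complex.Im x - complex.Im y.
  by case: x y => ? ? [].
have [|a Ha] := real_complete (u := fun n => complex.Re (u n)) (C := C).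
  by move=> n; rewrite -ReB (le_trans (cabs_ge_Re _)).
have [|b Hb] := real_complete (u := fun n => complex.Im (u n)) (C := C).
  by move=> n; rewrite -ImB (le_trans (cabs_ge_Im _)).
exists (a +i* b)%C => e e0; have e2 : 0 < e / 2 by rewrite divr_gt0.
have [N1 H1] := Ha _ e2; have [N2 H2] := Hb _ e2.
exists (maxn N1 N2) => n; rewrite geq_max => /andP[n1 n2].
rewrite (le_trans (cabs_le_parts _)) // ReB ImB /=.
by have := H1 n n1; have := H2 n n2; lra.
Qed.

Lemma complex_valued_scalars :
  valued_scalars (real_complex R) (fun z : R[i] => cabs z) (Num.conj : R[i] -> R[i]).
Proof.
split.
- by move=> x; rewrite -complex_le -complex_cabsE; apply: normr_ge0.
- move=> x x0; apply/eqP; rewrite -normr_eq0 complex_cabsE x0; exact: eqxx.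
- by move=> x y; rewrite -complex_le rmorphD /= -!complex_cabsE ler_normD.
- by move=> x y; apply: (@complexI R); rewrite rmorphM /= -!complex_cabsE normrM.
- move=> r; apply: (@complexI R); rewrite -complex_cabsE.
  exact: (norm_kap complex_le).
- exact: complex_geom_complete.
- exact: rmorphD.
- exact: rmorphM.
- exact: conjCK.
- by move=> r; apply: conjc_real.
- by move=> x; rewrite /cabs norm_conjC.
Qed.

Lemma complex_weakly_amenable (E : completeNormedModType R[i]) (mul : E -> E -> E)
    (star : E -> E) : complex_cstar_algebra mul star -> commutative mul ->
  ternary_weakly_amenable (Num.conj : R[i] -> R[i]) (cstar_triple mul star).
Proof.
move=> HA mC.
have nuE (x : E) := complex_cabsE x.
have abE (x : R[i]) := complex_cabsE x.
apply: (comm_cstar_weakly_amenable complex_le abE complex_valued_scalars nuE).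
split.
- split=> //; first exact: cstar_mulA HA.
  + exact: cstar_mulDl HA.
  + exact: cstar_scaleAl HA.
- exact: (real_norm_ge0 complex_le nuE).
- exact: (real_norm_eq0 nuE).
- exact: (real_norm_triangle complex_le nuE).
- exact: (real_normZ abE nuE).
- by move=> x y; rewrite -complex_le rmorphM /= -!nuE (cstar_normM HA).
- exact: (banach_geom_complete complex_le abE nuE).
- exact: cstar_starK HA.
- exact: cstar_starD HA.
- exact: cstar_starZ HA.
- by move=> x y; rewrite (cstar_starM HA) mC.
- by move=> x; apply: (@complexI R); rewrite rmorphXn /= -!nuE (cstar_norm HA).
move=> p q ps qs; rewrite -complex_le rmorphXn /= -!nuE.
by apply: (complex_sumsq HA) => //; rewrite mC.
Qed.

End Instances.

Theorem proposition3p11 (R : realType) :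
  (forall (E : completeNormedModType R[i]) (mul : E -> E -> E) (star : E -> E),
     complex_cstar_algebra mul star -> commutative mul ->
     ternary_weakly_amenable (Num.conj : R[i] -> R[i]) (cstar_triple mul star)) /\
  (forall (E : completeNormedModType R) (mul : E -> E -> E) (star : E -> E),
     real_cstar_algebra mul star -> commutative mul ->
     ternary_weakly_amenable (fun r : R => r) (cstar_triple mul star)).
Proof.
by split=> E mul star; [exact: complex_weakly_amenable | exact: real_weakly_amenable].
Qed.
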